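(* Let $X$ and $Y$ be finite partially ordered sets. For each $x\in X$ let $Y_x$ be a totally ordered subset of $Y$. Fix a set $\Psi$ of pairs $(x_1,x_2)$ of elements of $X$ with $x_1<x_2$. Let $T$ be the set of tableaux $f:X\to Y$ such that: $f(x)\in Y_x$ for all $x\in X$; $x_1\le x_2$ implies $f(x_1)\le f(x_2)$; and $(x_1,x_2)\in\Psi$ implies $f(x_1)<f(x_2)$. Let $E\subseteq X\times Y$ contain $\bigcup_{f\in T}f$. Then $\Delta(X,Y,T,E)$ is homeomorphic to a ball or sphere, and it is vertex-decomposable.
   Context: A tableau is a function $f:X\to Y$, identified with its graph in $X\times Y$. For a set $T$ of tableaux and $E\subseteq X\times Y$ containing every $f\in T$, put $v_{(x,y)}:=E\setminus\{(x,y)\}$ for $(x,y)\in E$. The tableau complex $\Delta(X,Y,T,E)$ is the simplicial complex on ground set $\{v_{(x,y)}:(x,y)\in E\}$ whose faces are the sets $\{v_{(x,y)}:(x,y)\in E\setminus F\}$ for $F\subseteq E$ containing (the graph of) some $f\in T$; the facets are the $f\in T$. A simplicial complex is vertex-decomposable if it is a simplex, or it is pure and has a vertex $v$ such that the deletion $\{C\in\Delta: v\notin C\}$ and the link $\{C\in\Delta: v\notin C,\ C\cup\{v\}\in\Delta\}$ are both vertex-decomposable. *)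

(* Defs.v *)
From HB Require Import structures.
From mathcomp Require Import all_boot all_order all_algebra.
From mathcomp Require Import all_classical all_reals all_analysis.

Set Implicit Arguments.
Unset Strict Implicit.
Unset Printing Implicit Defensive.

Import Order.TTheory GRing.Theory Num.Theory.
Import numFieldNormedType.Exports.

Local Open Scope ring_scope.

Section SimplicialComplexes.
Variable V : finType.
Implicit Types (D : {set {set V}}) (v : V).

Definition deletion v D : {set {set V}} :=
  [set C in D | v \notin C]%SET.

Definition link v D : {set {set V}} :=
  [set C : {set V} | (v \notin C) && ((v |: C)%SET \in D)]%SET.

Definition is_simplex D : Prop := exists S : {set V}, D = powerset S.

Definition is_facet D (C : {set V}) : Prop :=
  C \in D /\ (forall C' : {set V}, C' \in D -> C \subset C' -> C' = C).

Definition pure D : Prop :=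
  forall C C' : {set V}, is_facet D C -> is_facet D C' -> #|C| = #|C'|.

(* A vertex of D is a v with [set v] \in D, not merely an element of the
   ambient type.  The void complex (no faces at all, not even the empty one) is
   vertex-decomposable by convention, as a degenerate simplex; deletions and
   links at vertices always contain the empty face, so vd_void never occurs
   inside a derivation for a complex that has a face. *)
Inductive vertex_decomposable : {set {set V}} -> Prop :=
| vd_void : vertex_decomposable finset.set0
| vd_simplex D : is_simplex D -> vertex_decomposable D
| vd_shed D v :
    pure D ->
    [set v]%SET \in D ->
    vertex_decomposable (deletion v D) ->
    vertex_decomposable (link v D) ->
    vertex_decomposable D.

(* Barycentric coordinates, indexed by V through enum_rank; the support of a
   point must be a face. *)
Definition realization (R : realType) D : set 'rV[R]_#|V| :=
  [set p : 'rV[R]_#|V| | [/\ forall i, 0 <= p 0 i,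
                             \sum_i p 0 i = 1 &
      [set v | p 0 (enum_rank v) != 0]%SET \in D]]%classic.

End SimplicialComplexes.

Arguments realization {V} R D.

Definition homeomorphic (S T : topologicalType) : Prop :=
  exists (f : S -> T) (g : T -> S),
    [/\ continuous f, continuous g, cancel f g & cancel g f].

Definition unit_ball (R : realType) (n : nat) : set 'rV[R]_n :=
  [set p : 'rV[R]_n | \sum_i p 0 i ^+ 2 <= 1]%classic.

(* The sphere of dimension n - 1; it is empty for n = 0. *)
Definition unit_sphere (R : realType) (n : nat) : set 'rV[R]_n :=
  [set p : 'rV[R]_n | \sum_i p 0 i ^+ 2 = 1]%classic.

Arguments unit_ball R n : clear implicits.
Arguments unit_sphere R n : clear implicits.

Definition ball_or_sphere (R : realType) (V : finType) (D : {set {set V}}) :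
    Prop :=
  exists n : nat,
    homeomorphic (set_type (realization R D)) (set_type (unit_ball R n)) \/
    homeomorphic (set_type (realization R D)) (set_type (unit_sphere R n)).

Section TableauComplexes.
Variables X Y : finType.

Definition graph (f : {ffun X -> Y}) : {set X * Y} :=
  [set p : X * Y | p.2 == f p.1]%SET.

Definition tableau_vertex (E : {set X * Y}) (p : X * Y) : {set X * Y} :=
  (E :\ p)%SET.

Definition tableau_complex (T : {set {ffun X -> Y}}) (E : {set X * Y}) :
    {set {set {set X * Y}}} :=
  [set [set tableau_vertex E p | p in E :\: F]%SET
     | F : {set X * Y} in powerset E & [exists f in T, graph f \subset F]]%SET.

End TableauComplexes.

Definition poset_tableaux (dX dY : Order.disp_t)
    (X : finPOrderType dX) (Y : finPOrderType dY)
    (Yx : X -> {set Y}) (Psi : {set X * X}) : {set {ffun X -> Y}} :=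
  [set f : {ffun X -> Y} |
     [&& [forall x, f x \in Yx x],
         [forall x1, forall x2, (x1 <= x2)%O ==> (f x1 <= f x2)%O] &
         [forall x1, forall x2, ((x1, x2) \in Psi) ==> (f x1 < f x2)%O]]]%SET.

(* Main.v *)
Require Import Defs.
From HB Require Import structures.
From mathcomp Require Import all_boot all_order all_algebra.
From mathcomp Require Import all_classical all_reals all_analysis.
From mathcomp Require Import lra.

Set Implicit Arguments.
Unset Strict Implicit.
Unset Printing Implicit Defensive.

Import Order.TTheory GRing.Theory Num.Theory.
Import numFieldNormedType.Exports.

Local Open Scope classical_set_scope.
Local Open Scope ring_scope.

(** Let [T] be the set of tableaux. The vertices outside a face form a set [F]
   containing the graph of a tableau; the face should lie in the interior of the
   complex exactly when every function with graph inside [F] is in [T]. So the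
   complex should be a sphere if [T] contains all functions with graph in [E],
   and otherwise a ball whose boundary is its intersection with the complex of
   the functions outside [T].

   Let [x] be minimal among the points at which two tableaux differ, and let [y]
   be the least value of a tableau at [x]. Resetting the value at [x] to [y]
   maps [T] to itself. Hence [(x, y)] is a shedding vertex: its deletion and its
   link are the complexes of the tableaux with [f x = y] and with [f x <> y].

   For the topology, replace a complex by the cone of nonnegative vectors whose
   support is a face, and look for positively homogeneous homeomorphisms of this
   cone onto [R^m] (sphere) or onto [R^m x R>=0], boundary to boundary (ball).
   In these coordinates gluing the star of a vertex to its deletion along the
   link is an explicit shear, so no theorem on gluing balls is needed. *)

(** * Continuity on a subset *)

Section WithinContinuous.
Variables (S T U : topologicalType).
Implicit Types (A : set S) (B : set T).

Lemma within_continuous_compose A B (f : S -> T) (g : T -> U) :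
  (forall x, A x -> B (f x)) -> {within A, continuous f} ->
  {within B, continuous g} -> {within A, continuous (fun x => g (f x))}.
Proof.
move=> fAB /subspace_continuousP cf /subspace_continuousP cg.
apply/subspace_continuousP => x Ax P /(cg _ (fAB _ Ax)) nP.
have : \forall y \near x, A y -> B (f y) -> P (g (f y)).
  exact: (cf x Ax _ nP).
by apply: filterS => y + Ay; apply => //; exact: fAB.
Qed.

Lemma within_eq_continuous A (f g : S -> T) :
  (forall x, A x -> f x = g x) ->
  {within A, continuous f} -> {within A, continuous g}.
Proof. by move=> fg; apply: subspace_eq_continuous => x /set_mem /fg. Qed.

Lemma closed_preimage (f : S -> T) B :
  continuous f -> closed B -> closed (f @^-1` B).
Proof. by move=> cf; apply: preimage_closed => x _; exact: cf. Qed.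

Lemma continuous_comp_fst (f : S -> U) :
  continuous f -> continuous (fun z : S * T => f z.1).
Proof. by move=> cf z; apply: continuous_comp (cf z.1); exact: cvg_fst. Qed.

Lemma continuous_comp_snd (f : T -> U) :
  continuous f -> continuous (fun z : S * T => f z.2).
Proof. by move=> cf z; apply: continuous_comp (cf z.2); exact: cvg_snd. Qed.

Lemma continuous_pair (f : S -> T) (g : S -> U) :
  continuous f -> continuous g -> continuous (fun x => (f x, g x)).
Proof. by move=> cf cg x; apply: cvg_pair; [exact: cf|exact: cg]. Qed.

Lemma continuous_fst_fst : continuous (fun z : S * T * U => z.1.1).
Proof. by move=> z; apply: continuous_comp; exact: cvg_fst. Qed.

Lemma continuous_fst_snd : continuous (fun z : S * T * U => z.1.2).
Proof.
by move=> z; apply: continuous_comp; [exact: cvg_fst|exact: cvg_snd].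
Qed.

End WithinContinuous.

Lemma within_continuous_prod (S T S' T' : topologicalType) (A : set S)
    (A' : set S') (f : S -> T) (f' : S' -> T') :
  {within A, continuous f} -> {within A', continuous f'} ->
  {within A `*` A', continuous (fun z => (f z.1, f' z.2))}.
Proof.
move=> cf cf'; apply: continuous_pair.
  apply: (within_continuous_compose _ _ cf) => [z []//|].
  by apply: continuous_subspaceT => z; exact: cvg_fst.
apply: (within_continuous_compose _ _ cf') => [z []//|].
by apply: continuous_subspaceT => z; exact: cvg_snd.
Qed.

Lemma continuous_row (K : numFieldType) (S : topologicalType) n
    (f : S -> 'rV[K]_n) :
  (forall j, continuous (fun x => f x 0 j)) -> continuous f.
Proof.
move=> cf x P [Q nQ sQP].
suff : \forall y \near x, forall j, Q 0 j (f y 0 j).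
  by apply: filterS => y Qy; apply: sQP => i j; rewrite ord1; exact: Qy.
by apply: filter_forall => j; exact: cf.
Qed.

Lemma homeomorphic_set_type (S T : topologicalType) (A : set S) (B : set T)
    (f : S -> T) (g : T -> S) :
  {within A, continuous f} -> {within B, continuous g} ->
  (forall x, A x -> B (f x)) -> (forall y, B y -> A (g y)) ->
  (forall x, A x -> g (f x) = x) -> (forall y, B y -> f (g y) = y) ->
  homeomorphic (set_type A) (set_type B).
Proof.
have restrict_continuous (S' T' : topologicalType) (A' : set S') (B' : set T')
    (f' : S' -> T') (fAB : forall x, A' x -> B' (f' x)) :
    {within A', continuous f'} -> continuous (fun a : set_type A' =>
      exist _ (f' (sval a)) (mem_set (fAB _ (set_mem (svalP a))))
        : set_type B').
  move=> /subspace_sigL_continuousP/continuousP cf.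
  by apply/continuousP => _ [W oW <-]; exact: cf.
move=> cf cg fAB gBA fK gK.
exists (fun a => exist _ (f (sval a)) (mem_set (fAB _ (set_mem (svalP a))))).
exists (fun b => exist _ (g (sval b)) (mem_set (gBA _ (set_mem (svalP b))))).
split; [exact: restrict_continuous|exact: restrict_continuous| |].
  by move=> [x Ax]; apply: eq_sig_hprop => //=; rewrite fK//; exact: set_mem.
by move=> [x Ax]; apply: eq_sig_hprop => //=; rewrite gK//; exact: set_mem.
Qed.

(** * Positively homogeneous homeomorphisms *)

Section ConicalHomeomorphisms.
Variable R : realType.
Implicit Types U W Z : normedModType R.

Record conical_homeo U W (A : set U) (B : set W) (f : U -> W) (g : W -> U) :
    Prop := ConicalHomeo {
  homeo_continuous : {within A, continuous f};
  homeo_inv_continuous : {within B, continuous g};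
  homeo_maps : forall x, A x -> B (f x);
  homeo_inv_maps : forall y, B y -> A (g y);
  homeoK : forall x, A x -> g (f x) = x;
  homeo_invK : forall y, B y -> f (g y) = y;
  homeo_scale : forall (c : R) x, 0 < c -> A x -> A (c *: x);
  homeoZ : forall (c : R) x, 0 < c -> A x -> f (c *: x) = c *: f x }.

Lemma conical_homeo_id U (A : set U) :
  (forall (c : R) x, 0 < c -> A x -> A (c *: x)) -> conical_homeo A A id id.
Proof.
by move=> AZ; split => //; apply: continuous_subspaceT => x; exact: cvg_id.
Qed.

Lemma conical_homeo_sym U W (A : set U) (B : set W) f g :
  conical_homeo A B f g -> conical_homeo B A g f.
Proof.
move=> h.
have gZ (c : R) y : 0 < c -> B y -> f (c *: g y) = c *: y /\ A (c *: g y).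
  move=> c0 /[dup] By /(homeo_inv_maps h) Ag.
  rewrite (homeoZ h)// (homeo_invK h)//; split => //.
  exact: homeo_scale h _ _ _ _.
case: (h) => *; split => // c y c0 By; have [fcg Acg] := gZ c y c0 By.
  by rewrite -fcg; exact: homeo_maps h _ _.
by rewrite -fcg (homeoK h).
Qed.

Lemma conical_homeo_comp U W Z (A : set U) (B : set W) (C : set Z) f g f' g' :
  conical_homeo A B f g -> conical_homeo B C f' g' ->
  conical_homeo A C (fun x => f' (f x)) (fun z => g (g' z)).
Proof.
move=> [cf cg fAB gBA fK gK AZ fZ] [cf' cg' fBC gCB fK' gK' _ fZ'].
split; [exact: within_continuous_compose cf cf'
  |exact: within_continuous_compose cg' cg| | | | |exact: AZ|].
- by move=> x /fAB/fBC.
- by move=> z /gCB/gBA.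
- by move=> x Ax; rewrite fK' ?fK//; exact: fAB.
- by move=> z Cz; rewrite gK ?gK'//; exact: gCB.
- by move=> c x c0 Ax; rewrite fZ// fZ'//; exact: fAB.
Qed.

Lemma conical_homeo_prod U W U' W' (A : set U) (B : set W) (A' : set U')
    (B' : set W') f g f' g' :
  conical_homeo A B f g -> conical_homeo A' B' f' g' ->
  conical_homeo (A `*` A') (B `*` B')
    (fun z => (f z.1, f' z.2)) (fun z => (g z.1, g' z.2)).
Proof.
move=> [cf cg fAB gBA fK gK AZ fZ] [cf' cg' fAB' gBA' fK' gK' AZ' fZ'].
split; [exact: within_continuous_prod|exact: within_continuous_prod
  | | | | | |].
- by move=> z [/fAB ? /fAB'].
- by move=> z [/gBA ? /gBA'].
- by move=> [x x'] [/= ? ?]; rewrite fK// fK'.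
- by move=> [y y'] [/= ? ?]; rewrite gK// gK'.
- by move=> c z c0 [? ?]; split; [exact: AZ|exact: AZ'].
- by move=> c z c0 [? ?] /=; rewrite fZ// fZ'.
Qed.

Lemma conical_homeo_sub U W (A A' : set U) (B B' : set W) f g :
  A' `<=` A -> B' `<=` B -> (forall x, A x -> A' x <-> B' (f x)) ->
  (forall (c : R) x, 0 < c -> A' x -> A' (c *: x)) ->
  conical_homeo A B f g -> conical_homeo A' B' f g.
Proof.
move=> sA sB AB' AZ' [cf cg fAB gBA fK gK _ fZ].
split => //.
- exact: continuous_subspaceW cf.
- exact: continuous_subspaceW cg.
- by move=> x A'x; apply/AB' => //; exact: sA.
- by move=> y B'y; apply/AB'; [exact/gBA/sB|rewrite gK//; exact: sB].
- by move=> x /sA/fK.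
- by move=> y /sB/gK.
- by move=> c x c0 /sA/(fZ _ _ c0).
Qed.

Lemma conical_homeo_glue U W (A1 A2 : set U) (B1 B2 : set W) f1 g1 f2 g2 :
  closed A1 -> closed A2 -> closed B1 -> closed B2 ->
  conical_homeo A1 B1 f1 g1 -> conical_homeo A2 B2 f2 g2 ->
  (forall x, A1 x -> A2 x -> f1 x = f2 x) ->
  (forall y, B1 y -> B2 y -> A2 (g1 y)) ->
  exists f g, [/\ conical_homeo (A1 `|` A2) (B1 `|` B2) f g,
    forall x, A1 x -> f x = f1 x & forall x, A2 x -> f x = f2 x].
Proof.
move=> clA1 clA2 clB1 clB2 h1 h2 f12 B12.
have g12 y : B1 y -> B2 y -> g1 y = g2 y.
  move=> B1y B2y; rewrite -(homeoK h2 (B12 _ B1y B2y)) -f12 ?(homeo_invK h1)//.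
    exact: homeo_inv_maps h1 _ _.
  exact: B12.
pose f x := if x \in A1 then f1 x else f2 x.
pose g y := if y \in B1 then g1 y else g2 y.
have f1E x : A1 x -> f x = f1 x by rewrite /f => /mem_set ->.
have g1E y : B1 y -> g y = g1 y by rewrite /g => /mem_set ->.
have f2E x : A2 x -> f x = f2 x.
  by rewrite /f; case: ifP => // /set_mem; exact: f12.
have g2E y : B2 y -> g y = g2 y.
  by rewrite /g; case: ifP => // /set_mem; exact: g12.
case: h1 h2 => [cf1 cg1 fAB1 gBA1 fK1 gK1 AZ1 fZ1].
case=> [cf2 cg2 fAB2 gBA2 fK2 gK2 AZ2 fZ2].
exists f, g; split => //; split.
- apply: withinU_continuous => //.
    by apply: within_eq_continuous cf1 => x /f1E.
  by apply: within_eq_continuous cf2 => x /f2E.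
- apply: withinU_continuous => //.
    by apply: within_eq_continuous cg1 => x /g1E.
  by apply: within_eq_continuous cg2 => x /g2E.
- move=> x [] Ax; first by left; rewrite f1E//; exact: fAB1.
  by right; rewrite f2E//; exact: fAB2.
- move=> y [] By; first by left; rewrite g1E//; exact: gBA1.
  by right; rewrite g2E//; exact: gBA2.
- move=> x [] Ax; first by rewrite f1E// g1E ?fK1//; exact: fAB1.
  by rewrite f2E// g2E ?fK2//; exact: fAB2.
- move=> y [] By; first by rewrite g1E// f1E ?gK1//; exact: gBA1.
  by rewrite g2E// f2E ?gK2//; exact: gBA2.
- by move=> c x c0 [] Ax; [left; exact: AZ1|right; exact: AZ2].
- move=> c x c0 [] Ax; first by rewrite !f1E ?fZ1//; exact: AZ1.
  by rewrite !f2E ?fZ2//; exact: AZ2.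
Qed.

Definition gauge U (A : set U) (N : U -> R) :=
  [/\ {within A, continuous N},
      forall (c : R) x, 0 < c -> N (c *: x) = c * N x &
      forall x, A x -> x != 0 -> 0 < N x].

Lemma gauge_neq0 U (A : set U) N x : gauge A N -> N x = 1 -> x != 0.
Proof.
move=> [_ NZ _]; apply: contra_eq_neq => ->.
have /eqP := NZ 2 0 (ltr0Sn _ 1); rewrite scaler0 -subr_eq0 => /eqP N0.
by rewrite eq_sym; apply/eqP; lra.
Qed.

Lemma homeo_neq0 U W (A : set U) (B : set W) f g x :
  conical_homeo A B f g -> A x -> x != 0 -> f x != 0.
Proof.
move=> h Ax; apply: contra_neq => fx0.
have A2x : A (2 *: x) by exact: homeo_scale h _ _ _ _.
have /eqP : 2 *: x = x.
  by rewrite -[LHS](homeoK h)// (homeoZ h)// fx0 scaler0 -fx0 (homeoK h).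
by rewrite -[2]/(1 + 1) scalerDl scale1r -subr_eq0 addrK => /eqP.
Qed.

Definition slice U (A : set U) (N : U -> R) : set U := [set x | A x /\ N x = 1].

Definition normalize U (N : U -> R) (x : U) : U := (N x)^-1 *: x.

Section Slices.
Variables (U W : normedModType R) (A : set U) (B : set W).
Variables (f : U -> W) (g : W -> U) (N : U -> R) (M : W -> R).
Hypotheses (h : conical_homeo A B f g) (gN : gauge A N) (gM : gauge B M).

Lemma gauge_homeo_gt0 x : slice A N x -> 0 < M (f x).
Proof.
move=> [Ax Nx]; have [_ _] := gM; apply; first exact: homeo_maps h _ _.
by apply: homeo_neq0 h _ _ => //; exact: gauge_neq0 gN _.
Qed.

Lemma normalize_homeo_continuous :
  {within slice A N, continuous (fun x => normalize M (f x))}.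
Proof.
have cf : {within slice A N, continuous f}.
  by apply: continuous_subspaceW (homeo_continuous h) => x [].
have cM : {within slice A N, continuous (fun x => M (f x))}.
  have [cM _ _] := gM; apply: (within_continuous_compose _ cf cM) => x [Ax _].
  exact: homeo_maps h _ _.
move/subspace_continuousP: cf => cf; move/subspace_continuousP: cM => cM.
apply/subspace_continuousP => x Ax; apply: cvgZ (cf x Ax).
by apply: cvgV (cM x Ax); rewrite gt_eqF// gauge_homeo_gt0.
Qed.

Lemma slice_normalize_homeo x : slice A N x -> slice B M (normalize M (f x)).
Proof.
move=> Ax; have Mfx : 0 < M (f x) by exact: gauge_homeo_gt0.
have [_ MZ _] := gM; split; last by rewrite MZ ?invr_gt0// mulVf// gt_eqF.
apply: homeo_scale (conical_homeo_sym h) _ _ _ _; first by rewrite invr_gt0.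
by apply: homeo_maps h _ _; case: Ax.
Qed.

Lemma normalize_homeoK x :
  slice A N x -> normalize N (g (normalize M (f x))) = x.
Proof.
move=> /[dup] [[Ax Nx]] /gauge_homeo_gt0 Mfx.
have [_ NZ _] := gN; rewrite /normalize -(homeoZ h) ?invr_gt0//.
rewrite (homeoK h); last by apply: homeo_scale h _ _ _ _; rewrite ?invr_gt0.
by rewrite NZ ?invr_gt0// Nx mulr1 invrK scalerA divff ?scale1r// gt_eqF.
Qed.

End Slices.

Lemma homeomorphic_slice U W (A : set U) (B : set W) f g N M :
  conical_homeo A B f g -> gauge A N -> gauge B M ->
  homeomorphic (set_type (slice A N)) (set_type (slice B M)).
Proof.
move=> h gN gM; have h' := conical_homeo_sym h.
apply: (homeomorphic_set_type (f := fun x => normalize M (f x))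
  (g := fun y => normalize N (g y))).
- exact: normalize_homeo_continuous h gN gM.
- exact: normalize_homeo_continuous h' gM gN.
- by move=> x; exact: slice_normalize_homeo h gN gM _.
- by move=> y; exact: slice_normalize_homeo h' gM gN _.
- by move=> x; exact: normalize_homeoK h gN gM _.
- by move=> y; exact: normalize_homeoK h' gM gN _.
Qed.

End ConicalHomeomorphisms.

(** * Half-spaces *)

Section Halfspaces.
Variable R : realType.
Implicit Types W : normedModType R.

Definition halfline : set R := [set r | 0 <= r].

Definition halfspace W : set (W * R) := [set z | 0 <= z.2].

Lemma halflineZ (c r : R) : 0 < c -> halfline r -> halfline (c * r).
Proof. by move=> /ltW c0 r0; exact: mulr_ge0. Qed.

Lemma closed_le_continuous (S : topologicalType) (f g : S -> R) :
  continuous f -> continuous g -> closed [set x | f x <= g x].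
Proof.
move=> cf cg; have cgf : continuous (fun x => g x - f x).
  by move=> x; apply: cvgB; [exact: cg|exact: cf].
rewrite (_ : mkset _ = (fun x => g x - f x) @^-1` [set r | 0 <= r]).
  exact: closed_preimage cgf (@closed_ge _ 0).
by apply/seteqP; split => x /=; rewrite subr_ge0.
Qed.

Lemma halfspaceE W : @halfspace W = setT `*` halfline.
Proof. by apply/seteqP; split => [z|z []]. Qed.

Lemma closed_halfspace W : closed (@halfspace W).
Proof.
apply: (closed_le_continuous (f := fun=> 0) (g := snd)) => z.
  exact: cst_continuous.
exact: cvg_snd.
Qed.

(* [(u, t) |-> (u - t, min u t)] opens the quadrant into a half-plane. *)
Lemma conical_homeo_quadrant W :
  conical_homeo (@halfspace W `*` halfline) (@halfspace (W * R)%type)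
    (fun z => ((z.1.1, z.1.2 - z.2), Num.min z.1.2 z.2))
    (fun z => ((z.1.1, z.2 + Num.max z.1.2 0), z.2 + Num.max (- z.1.2) 0)).
Proof.
split.
- apply/continuous_subspaceT/continuous_pair; first apply: continuous_pair.
  + exact: continuous_fst_fst.
  + move=> z; apply: cvgB; last exact: cvg_snd.
    exact: continuous_fst_snd.
  + move=> z.
    exact: continuous_min (@continuous_fst_snd _ _ _ z) (@cvg_snd _ _ _ _ _).
- apply/continuous_subspaceT/continuous_pair; first apply: continuous_pair.
  + exact: continuous_fst_fst.
  + move=> z; apply: cvgD; first exact: cvg_snd.
    exact: continuous_max (@continuous_fst_snd _ _ _ z) (cvg_cst _).
  + move=> z; apply: cvgD; first exact: cvg_snd.
    exact: continuous_max
      (continuousN (@continuous_fst_snd _ _ _ z)) (cvg_cst _).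
- by move=> [[x u] t] [/= u0 t0]; rewrite /halfspace /= le_min u0.
- move=> [[x s] w] /= w0.
  by split; rewrite /halfspace /halfline /= addr_ge0// le_max lexx orbT.
- move=> [[x u] t] /= _; rewrite opprB.
  by congr (_, _, _); rewrite /Num.min /Num.max; do 2?[case: ltP => ?]; lra.
- move=> [[x s] w] /= _.
  by congr (_, _, _); rewrite /Num.min /Num.max;
    case: (ltP s 0) => ?; case: (ltP (- s) 0) => ?; do 1?[case: ltP => ?]; lra.
- by move=> c z c0 [z0 t0]; split; exact: halflineZ.
- move=> c [[x u] t] c0 _ /=; congr (_, _, _); first by rewrite -scalerBr.
  by apply/esym/minr_pMr; exact: ltW.
Qed.

Lemma conical_homeo_opp :
  conical_homeo halfline [set r : R | r <= 0] -%R -%R.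
Proof.
split.
- by apply: continuous_subspaceT => r; exact: cvgN.
- by apply: continuous_subspaceT => r; exact: cvgN.
- by move=> r; rewrite /halfline /= oppr_le0.
- by move=> r; rewrite /halfline /= oppr_ge0.
- by move=> r _; rewrite opprK.
- by move=> r _; rewrite opprK.
- exact: halflineZ.
- by move=> c r _ _; exact/esym/mulrN.
Qed.

Definition epigraph W (h : W -> R) : set (W * R) := [set z | h z.1 <= z.2].

Lemma closed_epigraph W (h : W -> R) : continuous h -> closed (epigraph h).
Proof.
move=> ch; apply: (closed_le_continuous (g := snd) (continuous_comp_fst ch)).
by move=> z; exact: cvg_snd.
Qed.

Lemma conical_homeo_epigraph W (h : W -> R) :
  continuous h -> (forall (c : R) x, 0 < c -> h (c *: x) = c * h x) ->
  conical_homeo (@halfspace W) (epigraph h)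
    (fun z => (z.1, z.2 + h z.1)) (fun z => (z.1, z.2 - h z.1)).
Proof.
move=> ch hZ; have ch1 : continuous (fun z : W * R => h z.1).
  exact: continuous_comp_fst.
split.
- apply/continuous_subspaceT/continuous_pair => z; first exact: cvg_fst.
  by apply: cvgD; [exact: cvg_snd|exact: ch1].
- apply/continuous_subspaceT/continuous_pair => z; first exact: cvg_fst.
  by apply: cvgB; [exact: cvg_snd|exact: ch1].
- by move=> z; rewrite /epigraph /= lerDr.
- by move=> z; rewrite /halfspace /= subr_ge0.
- by move=> [x r] _ /=; rewrite addrK.
- by move=> [x r] _ /=; rewrite subrK.
- by move=> c z c0 z0; exact: halflineZ.
- by move=> c [x r] c0 _ /=; rewrite hZ// -[c *: r + _]mulrDr.
Qed.

Lemma conical_homeo_shear W :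
  conical_homeo (@halfspace W `*` halfline)
    [set z : W * R * R | 0 <= z.2 <= z.1.2]
    (fun z => ((z.1.1, z.1.2 + z.2), z.1.2))
    (fun z => ((z.1.1, z.2), z.1.2 - z.2)).
Proof.
split.
- apply/continuous_subspaceT/continuous_pair; last exact: continuous_fst_snd.
  apply: continuous_pair => [|z]; first exact: continuous_fst_fst.
  by apply: cvgD; [exact: continuous_fst_snd|exact: cvg_snd].
- apply/continuous_subspaceT/continuous_pair => [|z].
    apply: continuous_pair => [|z]; last exact: cvg_snd.
    exact: continuous_fst_fst.
  by apply: cvgB; [exact: continuous_fst_snd|exact: cvg_snd].
- by move=> [[y u] t] [/= u0 t0]; rewrite u0 lerDl.
- move=> [[y w] u] /= /andP[u0 uw].
  by split; rewrite /halfline /halfspace /= ?subr_ge0.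
- by move=> [[y u] t] _ /=; rewrite addrC addKr.
- by move=> [[y w] u] _ /=; rewrite addrC subrK.
- by move=> c z c0 [u0 t0]; split; exact: halflineZ.
- by move=> c [[y u] t] c0 _ /=; rewrite -[c *: u + _]mulrDr.
Qed.

(* Slide the point [q] from its height [u] in the chart [f] up to [u + t], and
   record [u]. *)
Lemma conical_homeo_wedge (U W Z : normedModType R)
    (A : set U) (B : set Z) (f : U -> W * R) g k l (h : Z -> R) :
  conical_homeo A (@halfspace W) f g -> conical_homeo A B k l ->
  (forall x, A x -> h (k x) = (f x).2) ->
  conical_homeo (A `*` halfline) [set z | B z.1 /\ 0 <= z.2 <= h z.1]
    (fun z => (k (g ((f z.1).1, (f z.1).2 + z.2)), (f z.1).2))
    (fun z => (g ((f (l z.1)).1, z.2), (f (l z.1)).2 - z.2)).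
Proof.
move=> fg kl hk; have idR := conical_homeo_id halflineZ.
have toA : conical_homeo [set z : W * R * R | 0 <= z.2 <= z.1.2]
    [set z | A z.1 /\ 0 <= z.2 <= (f z.1).2]
    (fun z => (g z.1, z.2)) (fun z => (f z.1, z.2)).
  apply: conical_homeo_sub (conical_homeo_prod (conical_homeo_sym fg) idR).
  - by move=> z /= /andP[z0 z1]; split => //; exact: le_trans z1.
  - by move=> z /= [Az /andP[z0 _]].
  - move=> z [z1 _]; rewrite /= (homeo_invK fg z1).
    by split => [|[]//]; split => //; exact: homeo_inv_maps fg _ z1.
  - move=> c z /ltW c0 /andP[z0 z1]; apply/andP; split; first exact: mulr_ge0.
    exact: ler_wpM2l.
have toB : conical_homeo [set z | A z.1 /\ 0 <= z.2 <= (f z.1).2]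
    [set z | B z.1 /\ 0 <= z.2 <= h z.1]
    (fun z => (k z.1, z.2)) (fun z => (l z.1, z.2)).
  apply: conical_homeo_sub (conical_homeo_prod kl idR).
  - by move=> z /= [Az /andP[z0 _]].
  - by move=> z /= [Bz /andP[z0 _]].
  - move=> z [/= Az z2]; rewrite hk//.
    by split => -[_ zh]; split => //; exact: homeo_maps kl _ Az.
  - exact: homeo_scale (conical_homeo_sym toA).
exact: conical_homeo_comp (conical_homeo_prod fg idR)
  (conical_homeo_comp (@conical_homeo_shear W) (conical_homeo_comp toA toB)).
Qed.

Lemma conical_homeo_row_mx m n :
  conical_homeo [set: 'rV[R]_m * 'rV[R]_n] [set: 'rV[R]_(m + n)]
    (fun z => row_mx z.1 z.2) (fun x => (lsubmx x, rsubmx x)).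
Proof.
split => //.
- apply: continuous_subspaceT; apply: continuous_row => j.
  case: (split_ordP j) => k ->.
    under eq_fun do rewrite row_mxEl.
    exact: (continuous_comp_fst (f := fun x : 'rV_m => x 0 k)
      (@coord_continuous _ _ _ _ _)).
  under eq_fun do rewrite row_mxEr.
  exact: (continuous_comp_snd (f := fun x : 'rV_n => x 0 k)
    (@coord_continuous _ _ _ _ _)).
- apply: continuous_subspaceT; apply: continuous_pair;
    apply: continuous_row => j x; under eq_fun do rewrite mxE;
    exact: coord_continuous.
- by move=> [x y] _ /=; rewrite row_mxKl row_mxKr.
- by move=> x _; rewrite hsubmxK.
- by move=> c [x y] _ _ /=; rewrite scale_row_mx.
Qed.

Lemma conical_homeo_scalar_mx :
  conical_homeo [set: R] [set: 'rV[R]_1] (fun r => r%:M) (fun x => x 0 0).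
Proof.
split => //.
- apply: continuous_subspaceT; apply: continuous_row => j r.
  by rewrite ord1; under eq_fun do rewrite mxE; exact: cvg_id.
- by apply: continuous_subspaceT => x; exact: coord_continuous.
- by move=> r _; rewrite mxE.
- by move=> x _; apply/rowP => j; rewrite ord1 mxE.
- by move=> c r _ _; rewrite scale_scalar_mx.
Qed.

Lemma conical_homeo_prodR m : exists f g,
  @conical_homeo R ('rV[R]_m * R)%type 'rV[R]_(m + 1) setT setT f g.
Proof.
have idm : conical_homeo [set: 'rV[R]_m] [set: 'rV[R]_m] id id.
  exact: conical_homeo_id.
have := conical_homeo_prod idm conical_homeo_scalar_mx; rewrite !setXTT.
move=> /conical_homeo_comp/(_ (conical_homeo_row_mx m 1)) homeo.
by eexists; eexists; exact: homeo.
Qed.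

End Halfspaces.

(** * Cones over simplicial complexes *)

Section Complexes.
Import mathcomp.boot.fintype mathcomp.boot.finset.
Local Open Scope set_scope.
Variables (V : finType) (v : V).
Implicit Types (S C : {set V}) (D K : {set {set V}}).

Definition down_closed D := forall C C', C' \in D -> C \subset C' -> C \in D.

Definition join_vertex K : {set {set V}} := [set C : {set V} | C :\ v \in K].

Lemma down_closed_join_vertex K : down_closed K -> down_closed (join_vertex K).
Proof. by move=> dK C C'; rewrite !inE => C'K /(setSD [set v]); exact: dK. Qed.

Lemma down_closed_deletion D : down_closed D -> down_closed (deletion v D).
Proof.
move=> dD C C'; rewrite !inE => /andP[C'D vC'] CC'; rewrite (dD _ _ C'D CC') /=.
by apply: contra vC'; exact/subsetP.
Qed.

Lemma down_closed_link D : down_closed D -> down_closed (link v D).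
Proof.
move=> dD C C'; rewrite !inE => /andP[vC' C'D] CC'.
rewrite (dD _ _ C'D (setUS _ CC')) andbT.
by apply: contra vC'; exact/subsetP.
Qed.

Lemma link_sub_deletion D : down_closed D -> link v D \subset deletion v D.
Proof.
move=> dD; apply/subsetP => C; rewrite !inE => /andP[-> vCD].
by rewrite (dD _ _ vCD (subsetU1 _ _)).
Qed.

Lemma deletion_notin D C : C \in deletion v D -> v \notin C.
Proof. by rewrite inE => /andP[]. Qed.

Lemma link_notin D C : C \in link v D -> v \notin C.
Proof. by rewrite inE => /andP[]. Qed.

Lemma setD1_notin C : v \notin C -> C :\ v = C.
Proof. by rewrite -disjoints1 disjoint_sym => /setDidPl. Qed.

Lemma setD1_link D C : v \in C -> (C :\ v \in link v D) = (C \in D).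
Proof. by move=> vC; rewrite !inE eqxx setD1K. Qed.

Lemma deletionU_star D : down_closed D ->
  deletion v D :|: join_vertex (link v D) = D.
Proof.
move=> dD; apply/setP => C; rewrite in_setU [X in _ || X]inE.
case: (boolP (v \in C)) => vC; first by rewrite setD1_link// inE vC andbF.
rewrite (setD1_notin vC) inE vC andbT; apply/orb_idr => CL.
by have /subsetP/(_ _ CL) := link_sub_deletion dD; rewrite inE => /andP[].
Qed.

Lemma join_vertex_powerset S :
  v \in S -> join_vertex (powerset (S :\ v)) = powerset S.
Proof.
move=> vS; apply/setP => C; rewrite !inE subsetD1 setD11 andbT subDset.
by rewrite (setUidPr _)// sub1set.
Qed.

Lemma proper_setD1 S C : v \in S -> C \subset S ->
  (C \proper S) = (v \notin C) || (C :\ v \proper S :\ v).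
Proof.
move=> vS CS; rewrite !properE CS setSD//=; case: (boolP (v \in C)) => vC /=.
  by rewrite subsetD1 setD11 andbT subDset (setUidPr _)// sub1set.
by apply: contra vC => /subsetP; apply.
Qed.

End Complexes.

Section Cones.
Variables (R : realType) (V : finType).
Local Notation vec := 'rV[R]_#|V|.
Implicit Types (p q : vec) (u v : V) (D K : {set {set V}}).

Definition coord_at p u : R := p 0 (enum_rank u).

Definition support_at p : {set V} := [set u | coord_at p u != 0]%SET.

Definition cone D : set vec :=
  [set p | (forall u, 0 <= coord_at p u) /\ support_at p \in D].

Definition set_coord v p (t : R) : vec :=
  \row_j (if enum_val j == v then t else p 0 j).

Lemma coord_atP p q : (forall u, coord_at p u = coord_at q u) -> p = q.
Proof.
move=> pq; apply/rowP => j; have := pq (enum_val j).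
by rewrite /coord_at enum_valK.
Qed.

Lemma coord_at0 u : coord_at 0 u = 0.
Proof. exact: mxE. Qed.

Lemma coord_atZ c p u : coord_at (c *: p) u = c * coord_at p u.
Proof. exact: mxE. Qed.

Lemma coord_at_continuous u : continuous (fun p => coord_at p u).
Proof. exact: coord_continuous. Qed.

Lemma coord_at_set v p t u :
  coord_at (set_coord v p t) u = if u == v then t else coord_at p u.
Proof. by rewrite /coord_at mxE enum_rankK. Qed.

Lemma set_coord_set v p s t : set_coord v (set_coord v p s) t = set_coord v p t.
Proof. by apply: coord_atP => u; rewrite !coord_at_set; case: eqP. Qed.

Lemma set_coord_id v p t : coord_at p v = t -> set_coord v p t = p.
Proof.
by move=> <-; apply: coord_atP => u; rewrite coord_at_set; case: eqP => // ->.
Qed.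

Lemma set_coordZ c v p t : set_coord v (c *: p) (c * t) = c *: set_coord v p t.
Proof.
by apply: coord_atP => u; rewrite !(coord_at_set, coord_atZ); case: eqP.
Qed.

Lemma set_coord_continuous v :
  continuous (fun z : vec * R => set_coord v z.1 z.2).
Proof.
apply: continuous_row => j; under eq_fun do rewrite mxE.
case: (enum_val j == v); first by move=> z; exact: cvg_snd.
exact: (continuous_comp_fst (f := fun p : vec => p 0 j)
  (@coord_continuous _ _ _ _ _)).
Qed.

Lemma support_atZ c p : c != 0 -> support_at (c *: p) = support_at p.
Proof.
by move=> c0; apply/setP => u; rewrite !inE coord_atZ mulf_eq0 negb_or c0.
Qed.

Lemma support_at0 : support_at 0 = finset.set0.
Proof. by apply/setP => u; rewrite !inE coord_at0 eqxx. Qed.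

Lemma support_at_set0 v p :
  support_at (set_coord v p 0) = (support_at p :\ v)%SET.
Proof.
by apply/setP => u; rewrite !inE coord_at_set; case: (u =P v); rewrite ?eqxx.
Qed.

Lemma coneZ D (c : R) p : 0 < c -> cone D p -> cone D (c *: p).
Proof.
move=> c0 [p0 pD]; split=> [u|]; last by rewrite support_atZ// gt_eqF.
by rewrite coord_atZ mulr_ge0// ltW.
Qed.

Lemma cone_sub D D' : D \subset D' -> cone D `<=` cone D'.
Proof. by move=> /fintype.subsetP sDD' p [p0 /sDD']. Qed.

Lemma coneU D D' : cone (D :|: D')%SET = cone D `|` cone D'.
Proof.
apply/seteqP; split=> [p [p0]|p [] [p0 pD]].
- by rewrite inE => /orP[]; [left|right].
- by split => //; rewrite inE pD.
- by split => //; rewrite inE pD orbT.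
Qed.

Lemma closed_cone D : down_closed D -> closed (cone D).
Proof.
move=> dD.
have -> : cone D = \bigcup_(C in [set C | C \in D])
    \bigcap_(u in setT) ([set p | 0 <= coord_at p u] `&`
      [set p | u \notin C -> coord_at p u = 0]).
  apply/seteqP; split=> [p [p0 pD]|p [C /= CD pC]].
    exists (support_at p) => //= u _; split => //=.
    by rewrite inE negbK => /eqP.
  split=> [u|]; first by have [] := pC u I.
  apply: dD CD _; apply/fintype.subsetP => u; rewrite inE.
  by apply: contraNT => uC; apply/eqP; have [_] := pC u I; apply.
apply: closed_bigcup => [|C _]; first exact: finite_finset.
apply: closed_bigI => u _; apply: closedI.
  apply: closed_le_continuous; last exact: coord_at_continuous.
  exact: cst_continuous.
case: (boolP (u \in C)) => uC.
  by rewrite (_ : mkset _ = setT); [exact: closedT|apply/seteqP; split].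
rewrite (_ : mkset _ = (fun p => coord_at p u) @^-1` [set x | x = 0]).
  exact: (closed_preimage (@coord_at_continuous u) (@closed_eq _ 0)).
by apply/seteqP; split => p /=; auto.
Qed.

Lemma cone_coord0 D v p :
  (forall C : {set V}, C \in D -> v \notin C) -> cone D p -> coord_at p v = 0.
Proof. by move=> vD [_ /vD]; rewrite inE negbK => /eqP. Qed.

Lemma conical_homeo_join_vertex v K :
  (forall C : {set V}, C \in K -> v \notin C) ->
  conical_homeo (cone (join_vertex v K)) (cone K `*` @halfline R)
    (fun p => (set_coord v p 0, coord_at p v)) (fun z => set_coord v z.1 z.2).
Proof.
move=> vK; split.
- apply/continuous_subspaceT/continuous_pair; last exact: coord_at_continuous.
  have c0 : continuous (fun p : vec => (p, 0 : R)).
    by apply: continuous_pair => p; [exact: cvg_id|exact: cst_continuous].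
  by move=> p; exact: continuous_comp (c0 p) (@set_coord_continuous v _).
- apply: continuous_subspaceT; exact: set_coord_continuous.
- move=> p [p0]; rewrite inE -support_at_set0 => pK; split; last exact: p0.
  by split=> [u|//] /=; rewrite coord_at_set; case: eqP.
- move=> [q t] /= [Kq t0]; have qv := cone_coord0 vK Kq.
  case: Kq => q0 qK; split=> [u|]; first by rewrite coord_at_set; case: eqP.
  by rewrite inE -support_at_set0 set_coord_set set_coord_id.
- by move=> p _; rewrite set_coord_set set_coord_id.
- move=> [q t] /= [Kq _]; rewrite coord_at_set eqxx set_coord_set.
  by rewrite set_coord_id// (cone_coord0 vK Kq).
- by move=> c p; exact: coneZ.
- by move=> c p _ _; rewrite coord_atZ -{1}[0](mulr0 c) set_coordZ.
Qed.

End Cones.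

(** * Conical balls and spheres *)

Section ConicalBalls.
Variables (R : realType) (V : finType).
Local Notation vec := 'rV[R]_#|V|.
Implicit Types (p : vec) (v : V) (S C : {set V}) (D K B : {set {set V}}).

(* Homogeneity lets such a homeomorphism descend to the realizations: [R^m]
   becomes a sphere and the half-space a ball. *)
Definition conical_sphere D := exists m f g,
  conical_homeo (cone D) [set: 'rV[R]_m] f g.

(* Only the faces of [D] in [B] matter: they form the boundary. *)
Definition ball_chart D B m (f : vec -> 'rV[R]_m * R) g :=
  conical_homeo (cone D) (@halfspace R 'rV[R]_m) f g /\
  forall p, cone D p -> ((f p).2 == 0) = (support_at p \in B).

Definition conical_ball D B := exists m f g, @ball_chart D B m f g.

Lemma eq_conical_ball D B B' : {in D, B =i B'} ->
  conical_ball D B -> conical_ball D B'.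
Proof.
move=> BB' [m [f [g [h hB]]]]; exists m, f, g; split => // p Dp.
by rewrite hB// BB'//; case: Dp.
Qed.

Lemma conical_sphere_prodR D m f g :
  conical_homeo (cone D) [set: 'rV[R]_m * R] f g -> conical_sphere D.
Proof.
move=> h; have [f' [g' h']] := conical_homeo_prodR R m.
by exists (m + 1)%N; do 2 eexists; exact: conical_homeo_comp h h'.
Qed.

Lemma conical_ball_prodR D B m f g :
  conical_homeo (cone D) (@halfspace R ('rV[R]_m * R)%type) f g ->
  (forall p, cone D p -> ((f p).2 == 0) = (support_at p \in B)) ->
  conical_ball D B.
Proof.
move=> h hB; have [f' [g' h']] := conical_homeo_prodR R m.
have := conical_homeo_prod h' (conical_homeo_id (@halflineZ R)).
rewrite -!halfspaceE => h''; exists (m + 1)%N; do 2 eexists.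
by split; [exact: conical_homeo_comp h h''|exact: hB].
Qed.

Lemma conical_sphere_empty_face : conical_sphere [set finset.set0]%SET.
Proof.
have cone0 p : cone [set finset.set0]%SET p -> p = 0.
  move=> [_]; rewrite inE => /eqP p0; apply: coord_atP => u; rewrite coord_at0.
  by move/setP/(_ u): p0; rewrite !inE => /negbFE/eqP.
exists 0%N, (fun=> 0), (fun=> 0); split => //.
- by apply: continuous_subspaceT => p; exact: cst_continuous.
- by apply: continuous_subspaceT => x; exact: cst_continuous.
- by move=> x _; split=> [u|]; rewrite ?coord_at0// support_at0 inE.
- by move=> p /cone0.
- by move=> x _; rewrite [x]thinmx0.
- by move=> c p; exact: coneZ.
- by move=> c p _ _; rewrite scaler0.
Qed.

Lemma conical_ball_join_sphere v K :
  (forall C, C \in K -> v \notin C) -> conical_sphere K ->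
  conical_ball (join_vertex v K) K.
Proof.
move=> vK [m [f [g h]]]; have join := conical_homeo_join_vertex R vK.
have := conical_homeo_prod h (conical_homeo_id (@halflineZ R)).
rewrite -halfspaceE => /(conical_homeo_comp join) h'.
exists m; do 2 eexists; split; first exact: h'.
move=> p [_]; rewrite inE /= -support_at_set0 => pK; apply/eqP/idP => [pv|Kp].
  by move: pK; rewrite set_coord_id.
by apply/eqP; have := vK _ Kp; rewrite inE negbK.
Qed.

Lemma conical_ball_join_ball v K B :
  (forall C, C \in K -> v \notin C) -> conical_ball K B ->
  conical_ball (join_vertex v K)
    (join_vertex v B :|: [set C : {set V} | v \notin C])%SET.
Proof.
move=> vK [m [f [g [h hB]]]].
have := conical_homeo_prod h (conical_homeo_id (@halflineZ R)).
move=> /(conical_homeo_comp (conical_homeo_join_vertex R vK)) h'.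
have h'' := conical_homeo_comp h' (@conical_homeo_quadrant R _).
apply: (conical_ball_prodR h'').
move=> p jp; have [/= Kp pv] := homeo_maps (conical_homeo_join_vertex R vK) jp.
rewrite !inE /= negbK -support_at_set0 -hB//.
have := homeo_maps h Kp; rewrite /halfspace /= le_eqVlt eq_sym.
case/predU1P => [-> | fp]; first by rewrite min_l// eqxx.
move: pv; rewrite /halfline /= le_eqVlt eq_sym => /predU1P[->|pv].
  by rewrite eqxx min_r ?ltW// eqxx orbT.
by rewrite !gt_eqF// lt_min fp.
Qed.

Lemma conical_ball_simplex S : S != finset.set0 ->
  conical_ball (powerset S) [set C : {set V} | C \proper S]%SET.
Proof.
have [n] := ubnP #|S|; elim: n S => // n IHn S; rewrite ltnS => Sn Sn0.
have [v vS] := finset.set0Pn _ Sn0.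
have vK C : C \in powerset (S :\ v)%SET -> v \notin C.
  by rewrite inE subsetD1 => /andP[].
rewrite -(join_vertex_powerset vS).
have [S0|S'n0] := eqVneq (S :\ v)%SET finset.set0.
  have sphere0 : conical_sphere (powerset (S :\ v)%SET).
    by rewrite S0 powerset0; exact: conical_sphere_empty_face.
  apply: eq_conical_ball (conical_ball_join_sphere vK sphere0) => C.
  rewrite join_vertex_powerset// S0 !inE => CS.
  rewrite (proper_setD1 vS)// S0 [X in _ || X]properE finset.sub0set andbF orbF.
  by rewrite -S0 subsetD1 CS.
have S'n : (#|(S :\ v)%SET| < n)%N.
  by apply: leq_trans Sn; rewrite [X in (_ < X)%N](cardsD1 v) vS.
apply: eq_conical_ball (conical_ball_join_ball vK (IHn _ S'n S'n0)) => C.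
by rewrite join_vertex_powerset// !inE => CS; rewrite (proper_setD1 vS)// orbC.
Qed.

End ConicalBalls.

(** * Attaching the star of a vertex *)

Section BallCharts.
Variables (R : realType) (V : finType) (D B : {set {set V}}) (m : nat).
Local Notation vec := 'rV[R]_#|V|.
Variables (f : vec -> 'rV[R]_m * R) (g : 'rV[R]_m * R -> vec).
Hypothesis fg : ball_chart D B f g.
Implicit Types (x : 'rV[R]_m) (K : {set {set V}}).

Let h : conical_homeo (cone D) (@halfspace R 'rV[R]_m) f g := proj1 fg.

Let base_halfspace x : halfspace (x, 0 : R).
Proof. exact: lexx. Qed.

Lemma cone_base x : cone D (g (x, 0)).
Proof. exact: homeo_inv_maps h _ (base_halfspace x). Qed.

Lemma chart_base x : f (g (x, 0)) = (x, 0).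
Proof. exact: homeo_invK h _ (base_halfspace x). Qed.

Lemma support_base x : support_at (g (x, 0)) \in B.
Proof. by have [_ <-] := fg; [rewrite chart_base|exact: cone_base]. Qed.

Lemma base_continuous : continuous (fun x => g (x, 0)).
Proof.
apply/continuous_subspace_setT.
apply: (within_continuous_compose _ _ (homeo_inv_continuous h)) => [x _|].
  exact: base_halfspace.
apply/continuous_subspaceT/continuous_pair => x; first exact: cvg_id.
exact: cst_continuous.
Qed.

Lemma baseZ (c : R) x : 0 < c -> g (c *: x, 0) = c *: g (x, 0).
Proof.
move=> c0; rewrite -(homeoZ (conical_homeo_sym h) c0 (base_halfspace x)).
by congr (g (_, _)); exact/esym/mulr0.
Qed.

Section BoundarySubcomplex.
Variable K : {set {set V}}.
Hypotheses (sKD : K \subset D) (sKB : K \subset B).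

Lemma chart_boundary p : cone K p -> f p = ((f p).1, 0).
Proof.
move=> Kp; have [_ fB] := fg; rewrite {1}[f p]surjective_pairing; congr pair.
apply/eqP; rewrite fB; first by apply: (fintype.subsetP sKB); case: Kp.
exact: cone_sub sKD _ Kp.
Qed.

Lemma chart_boundaryK p : cone K p -> g ((f p).1, 0) = p.
Proof.
move=> Kp; rewrite -(chart_boundary Kp) (homeoK h)//.
exact: cone_sub sKD _ Kp.
Qed.

Lemma conical_homeo_boundary :
  conical_homeo (cone K) [set x | cone K (g (x, 0))]
    (fun p => (f p).1) (fun x => g (x, 0)).
Proof.
have sK := cone_sub (R := R) sKD; split => //.
- have cf := continuous_subspaceW sK (homeo_continuous h).
  by move=> p; apply: cvg_comp (cf p) _; exact: cvg_fst.
- exact/continuous_subspaceT/base_continuous.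
- by move=> p Kp /=; rewrite chart_boundaryK.
- exact: chart_boundaryK.
- by move=> x _; rewrite chart_base.
- by move=> c p; exact: coneZ.
- by move=> c p c0 Kp; rewrite (homeoZ h)//; exact: sK.
Qed.

End BoundarySubcomplex.

End BallCharts.

Section VertexStar.
Variables (R : realType) (V : finType) (v : V) (D : {set {set V}}).
Local Notation vec := 'rV[R]_#|V|.
Hypothesis dD : down_closed D.

Lemma cone_deletion_star :
  cone D = cone (deletion v D) `|` cone (join_vertex v (link v D)) :> set vec.
Proof. by rewrite -coneU deletionU_star. Qed.

Lemma cone_link_star :
  cone (link v D) `<=` (cone (join_vertex v (link v D)) : set vec).
Proof.
apply: cone_sub; apply/fintype.subsetP => C CL; rewrite inE.
by rewrite setD1_notin// (link_notin CL).
Qed.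

Lemma cone_deletion_coord (p : vec) : cone (deletion v D) p -> coord_at p v = 0.
Proof. exact/cone_coord0/(@deletion_notin _ v D). Qed.

Lemma cone_star_link (p : vec) :
  cone (join_vertex v (link v D)) p -> coord_at p v = 0 -> cone (link v D) p.
Proof.
move=> sp pv; have h := conical_homeo_join_vertex R (@link_notin V v D).
by have [/=] := homeo_maps h sp; rewrite set_coord_id.
Qed.

End VertexStar.

Lemma conical_sphere_glue (R : realType) (V : finType) (v : V)
    (D : {set {set V}}) :
  down_closed D -> conical_ball R (deletion v D) (link v D) ->
  conical_sphere R D.
Proof.
move=> dD [m [f [g fg]]]; have [h _] := fg.
have sLd := link_sub_deletion v dD; set lk := link v D in fg sLd *.
have boundary : conical_homeo (cone lk) setT
    (fun p => (f p).1) (fun x => g (x, 0)).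
  rewrite (_ : setT = [set x | cone lk (g (x, 0))]).
    exact: (conical_homeo_boundary fg sLd (fintype.subxx _)).
  apply/seteqP; split => // x _; split; last exact: support_base fg _.
  by case: (cone_base fg x).
have star := conical_homeo_comp
  (conical_homeo_join_vertex R (@link_notin V v D))
  (conical_homeo_prod boundary (@conical_homeo_opp R)).
have lowerE : setT `*` [set r | r <= 0] = [set z : 'rV[R]_m * R | z.2 <= 0].
  by apply/seteqP; split => [z []|].
rewrite lowerE in star.
have closed_lower : closed [set z : 'rV[R]_m * R | z.2 <= 0].
  apply: (closed_le_continuous (f := snd) (g := fun=> 0)) => z.
    exact: cvg_snd.
  exact: cst_continuous.
have agree p : cone (deletion v D) p -> cone (join_vertex v lk) p ->
    f p = ((f (set_coord v p 0)).1, - coord_at p v).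
  move=> dp sp; have pv := cone_deletion_coord dp.
  rewrite set_coord_id// pv oppr0.
  exact: (chart_boundary fg sLd (fintype.subxx _) (cone_star_link sp pv)).
have compatible y : halfspace y -> y.2 <= 0 -> cone (join_vertex v lk) (g y).
  move=> y0 y0'; apply: cone_link_star; rewrite [y]surjective_pairing.
  rewrite (_ : y.2 = 0); last by apply/eqP; rewrite eq_le y0'.
  exact: homeo_inv_maps boundary _ I.
have [F [G [H _ _]]] := conical_homeo_glue
  (closed_cone (down_closed_deletion dD))
  (closed_cone (down_closed_join_vertex (down_closed_link dD)))
  (@closed_halfspace R 'rV[R]_m) closed_lower h star agree compatible.
apply: (@conical_sphere_prodR _ _ _ m F G).
rewrite (cone_deletion_star R v dD).
rewrite (_ : setT = @halfspace R 'rV[R]_m `|` [set z | z.2 <= 0])//.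
by apply/seteqP; split => // z _; apply/orP/le_total.
Qed.

Section BallGluing.
Variables (R : realType) (V : finType) (v : V) (D D' : {set {set V}}).
Local Notation vec := 'rV[R]_#|V|.
Local Notation del := (deletion v D).
Local Notation lk := (link v D).
Hypotheses (dD : down_closed D) (dD' : down_closed D').
Hypothesis link_sub : (lk :&: D' \subset link v D')%SET.
Variables (m n : nat).
Variables (f : vec -> 'rV[R]_m * R) (g : 'rV[R]_m * R -> vec).
Variables (f' : vec -> 'rV[R]_n * R) (g' : 'rV[R]_n * R -> vec).
Hypotheses (fg : ball_chart del (lk :|: D')%SET f g).
Hypotheses (fg' : ball_chart lk (link v D') f' g').
Implicit Types (p : vec) (x : 'rV[R]_m).

Let h : conical_homeo (cone del) (@halfspace R 'rV[R]_m) f g := proj1 fg.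
Let h' : conical_homeo (cone lk) (@halfspace R 'rV[R]_n) f' g' := proj1 fg'.
Let lk_del : lk \subset del := link_sub_deletion v dD.
Let lk_bd : lk \subset (lk :|: D')%SET := finset.subsetUl _ _.

(* The height over the boundary of the link, transported to the boundary of the
   deletion and extended by zero. *)
Definition height x : R :=
  if support_at (g (x, 0)) \in lk then (f' (g (x, 0))).2 else 0.

Lemma height_link x : cone lk (g (x, 0)) -> height x = (f' (g (x, 0))).2.
Proof. by move=> [_ gL]; rewrite /height gL. Qed.

Lemma height_notin_link x : support_at (g (x, 0)) \notin lk -> height x = 0.
Proof. by rewrite /height => /negbTE ->. Qed.

Lemma cone_link_base x : support_at (g (x, 0)) \in lk -> cone lk (g (x, 0)).
Proof. by split => //; case: (cone_base fg x). Qed.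

Lemma height_gt0_link x : 0 < height x -> cone lk (g (x, 0)).
Proof.
move=> hx; apply: cone_link_base; apply: contraLR hx => /height_notin_link ->.
by rewrite ltxx.
Qed.

Lemma height_ge0 x : 0 <= height x.
Proof.
have [/cone_link_base gL|/height_notin_link ->//] :=
  boolP (support_at (g (x, 0)) \in lk).
by rewrite height_link//; exact: homeo_maps h' _ gL.
Qed.

Lemma height_chart p : cone lk p -> height (f p).1 = (f' p).2.
Proof.
by move=> Lp; rewrite height_link (chart_boundaryK fg lk_del lk_bd Lp).
Qed.

Lemma heightZ (c : R) x : 0 < c -> height (c *: x) = c * height x.
Proof.
move=> c0; rewrite /height (baseZ fg)// support_atZ ?gt_eqF//.
case: ifP => [/cone_link_base gL|_]; last by rewrite mulr0.
by rewrite (homeoZ h').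
Qed.

Lemma height_continuous : continuous height.
Proof.
have cbase := base_continuous fg.
have cover : setT = (fun x => g (x, 0)) @^-1` cone lk `|`
                    (fun x => g (x, 0)) @^-1` cone D'.
  apply/seteqP; split => // x _; have [g0 _] := cone_base fg x.
  by have := support_base fg x; rewrite inE => /orP[]; [left|right].
apply/continuous_subspace_setT; rewrite cover; apply: withinU_continuous.
- exact/(closed_preimage cbase)/closed_cone/down_closed_link.
- exact/(closed_preimage cbase)/closed_cone.
- apply: (@within_eq_continuous _ _ _ (fun x => (f' (g (x, 0))).2)).
    by move=> x /height_link.
  have cf' : {within (fun x => g (x, 0)) @^-1` cone lk,
      continuous (fun x => f' (g (x, 0)))}.
    apply: (within_continuous_compose _ _ (homeo_continuous h')) => [//|].
    exact: continuous_subspaceT.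
  by move=> x; apply: cvg_comp (cf' x) _; exact: cvg_snd.
- apply: (@within_eq_continuous _ _ _ (fun=> 0)) => [x [gx0 gD']|].
    have [gL|/height_notin_link ->//] := boolP (support_at (g (x, 0)) \in lk).
    rewrite height_link; last exact: cone_link_base.
    apply/esym/eqP; have [_ ->] := fg'; last exact: cone_link_base.
    by apply: (fintype.subsetP link_sub); rewrite inE gL.
  by apply: continuous_subspaceT; exact: cst_continuous.
Qed.

(* The star is mapped onto the region below the graph of [height], and the
   deletion is sheared onto the region above; together they fill the
   half-space. *)
Definition wedge : set ('rV[R]_m * R) :=
  [set z | cone lk (g (z.1, 0)) /\ 0 <= z.2 <= height z.1].

Lemma conical_homeo_deletion :
  conical_homeo (cone del) (epigraph height)
    (fun p => ((f p).1, (f p).2 + height (f p).1))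
    (fun z => g (z.1, z.2 - height z.1)).
Proof.
exact: conical_homeo_comp h (conical_homeo_epigraph height_continuous heightZ).
Qed.

Definition star_chart p : 'rV[R]_m * R :=
  let: (y, u) := f' (set_coord v p 0) in
  ((f (g' (y, u + coord_at p v))).1, u).

Let join_link :
  conical_homeo (cone (join_vertex v lk)) (cone lk `*` @halfline R)
    (fun p => (set_coord v p 0, coord_at p v)) (fun z => set_coord v z.1 z.2) :=
  conical_homeo_join_vertex R (@link_notin V v D).

Lemma conical_homeo_star : exists G,
  conical_homeo (cone (join_vertex v lk)) wedge star_chart G.
Proof.
have boundary := conical_homeo_boundary fg lk_del lk_bd.
have := conical_homeo_comp join_link
  (conical_homeo_wedge h' boundary height_chart).
rewrite (_ : (fun p => _) = star_chart) => [star|].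
  by eexists; exact: star.
by apply/funext => p; rewrite /star_chart /=; case: (f' _).
Qed.

Lemma closed_wedge : closed wedge.
Proof.
rewrite (_ : wedge = (fun z => g (z.1, 0)) @^-1` cone lk `&`
    (@halfspace R 'rV[R]_m `&` [set z | z.2 <= height z.1])); last first.
  apply/seteqP; split => z /= [Lz]; first by move=> /andP[z0 z1].
  by move=> [z0 z1]; split => //; apply/andP.
apply: closedI; first apply: closed_preimage.
- exact: (continuous_comp_fst (base_continuous fg)).
- exact/closed_cone/down_closed_link.
apply: closedI; first exact: closed_halfspace.
apply: (closed_le_continuous (f := snd)) => [z|]; first exact: cvg_snd.
exact: (continuous_comp_fst height_continuous).
Qed.

Lemma epigraphU_wedge : epigraph height `|` wedge = @halfspace R 'rV[R]_m.
Proof.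
apply/seteqP; split=> [z []|[x r] r0].
- by rewrite /epigraph /=; exact/le_trans/height_ge0.
- by move=> [_ /andP[]].
- have [hr|rh] := leP (height x) r; [by left|right].
  split; last by rewrite /= r0 ltW.
  by apply: height_gt0_link; exact: le_lt_trans rh.
Qed.

Lemma star_chart_link p : cone lk p -> star_chart p = ((f p).1, (f' p).2).
Proof.
move=> Lp; have pv : coord_at p v = 0 by exact/(cone_coord0 _ Lp)/link_notin.
rewrite /star_chart set_coord_id// pv; have := homeoK h' Lp.
by case: (f' p) => y u /=; rewrite addr0 => ->.
Qed.

Lemma deletion_boundary p : cone del p ->
  ((f p).2 + height (f p).1 == 0) = (support_at p \in D').
Proof.
move=> dp; have f0 := homeo_maps h dp; have [_ fB] := fg.
rewrite paddr_eq0 ?height_ge0// fB// inE.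
have [pL|pL] /= := boolP (support_at p \in lk).
  have Lp : cone lk p by split => //; case: dp.
  rewrite height_chart//; have [_ ->//] := fg'; apply/idP/idP => [|pD'].
    by rewrite inE => /andP[_ vpD']; exact: dD' vpD' (subsetU1 _ _).
  by apply: (fintype.subsetP link_sub); rewrite inE pL.
apply/andb_idr => pD'; have /eqP fp : (f p).2 == 0 by rewrite fB// inE pD' orbT.
by rewrite height_notin_link// -fp -surjective_pairing (homeoK h).
Qed.

Lemma star_boundary p : cone (join_vertex v lk) p -> coord_at p v != 0 ->
  ((star_chart p).2 == 0) = (support_at p \in D').
Proof.
move=> sp pv; have [/= Lq _] := homeo_maps join_link sp.
rewrite -(@setD1_link _ v); last by rewrite inE.
rewrite -support_at_set0; have [_ <-//] := fg'.
by rewrite /star_chart; case: (f' _).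
Qed.

Lemma conical_ball_glue_charts : conical_ball R D D'.
Proof.
have [G star] := conical_homeo_star.
have agree p : cone del p -> cone (join_vertex v lk) p ->
    ((f p).1, (f p).2 + height (f p).1) = star_chart p.
  move=> dp sp; have Lp := cone_star_link sp (cone_deletion_coord dp).
  rewrite star_chart_link// height_chart//.
  by rewrite {2}(chart_boundary fg lk_del lk_bd Lp) add0r.
have compatible z : epigraph height z -> wedge z ->
    cone (join_vertex v lk) (g (z.1, z.2 - height z.1)).
  move=> zh [Lz /andP[_ hz]]; apply: cone_link_star.
  by rewrite (_ : z.2 = height z.1) ?subrr//; apply/eqP; rewrite eq_le hz.
have [F [G' [H Fdel Fstar]]] := conical_homeo_glue
  (closed_cone (down_closed_deletion dD))
  (closed_cone (down_closed_join_vertex (down_closed_link dD)))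
  (closed_epigraph height_continuous) closed_wedge
  conical_homeo_deletion star agree compatible.
exists m, F, G'; rewrite /ball_chart (cone_deletion_star R v dD).
rewrite -epigraphU_wedge; split => // p [dp|sp].
  by rewrite Fdel//= deletion_boundary.
have [pv|pv] := eqVneq (coord_at p v) 0; last by rewrite Fstar// star_boundary.
have dp : cone del p by exact/(cone_sub lk_del)/cone_star_link.
by rewrite Fdel//= deletion_boundary.
Qed.

End BallGluing.

Lemma conical_ball_glue (R : realType) (V : finType) (v : V)
    (D D' : {set {set V}}) :
  down_closed D -> down_closed D' -> (link v D :&: D' \subset link v D')%SET ->
  conical_ball R (deletion v D) (link v D :|: D')%SET ->
  conical_ball R (link v D) (link v D') ->
  conical_ball R D D'.
Proof.
move=> dD dD' sLD' [m [f [g fg]]] [n [f' [g' fg']]].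
exact: (conical_ball_glue_charts dD dD' sLD' fg fg').
Qed.

(** * From conical charts to balls and spheres *)

Lemma homeomorphic_trans (S T U : topologicalType) :
  homeomorphic S T -> homeomorphic T U -> homeomorphic S U.
Proof.
move=> [f [g [cf cg fK gK]]] [f' [g' [cf' cg' fK' gK']]].
exists (f' \o f), (g \o g'); split; [| |exact: can_comp|exact: can_comp].
  by move=> x; apply: continuous_comp; [exact: cf|exact: cf'].
by move=> x; apply: continuous_comp; [exact: cg'|exact: cg].
Qed.

Section Norms.
Variable R : realType.

Definition mass m (x : 'rV[R]_m) : R := \sum_i x 0 i.

Lemma gauge_mass (V : finType) (D : {set {set V}}) :
  gauge (cone D) (@mass #|V|).
Proof.
split.
- apply/continuous_subspaceT/continuous_big; first exact: add_continuous.
  by move=> i _; exact: coord_continuous.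
- by move=> c p _; rewrite mulr_sumr; apply: eq_bigr => i _; rewrite mxE.
- move=> p [p0 _] pn0; have p0' i : 0 <= p 0 i.
    by have := p0 (enum_val i); rewrite /coord_at enum_valK.
  rewrite lt_neqAle eq_sym sumr_ge0// andbT; apply: contra pn0.
  rewrite psumr_eq0// => /allP mp; apply/eqP/rowP => i; rewrite mxE.
  exact/eqP/(mp i (mem_index_enum _)).
Qed.

Lemma realization_slice (V : finType) (D : {set {set V}}) :
  realization R D = slice (cone D) (@mass #|V|).
Proof.
apply/seteqP; split => p [].
  by move=> p0 p1 pD; split => //; split => // u; exact: p0.
move=> [p0 pD] p1; split => // i.
by have := p0 (enum_val i); rewrite /coord_at enum_valK.
Qed.

Definition sqnorm m (x : 'rV[R]_m) : R := \sum_i x 0 i ^+ 2.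

Lemma sqnorm_ge0 m (x : 'rV[R]_m) : 0 <= sqnorm x.
Proof. by apply: sumr_ge0 => i _; exact: sqr_ge0. Qed.

Lemma sqnorm_eq0 m (x : 'rV[R]_m) : (sqnorm x == 0) = (x == 0).
Proof.
rewrite psumr_eq0 => [|i _]; last exact: sqr_ge0.
apply/allP/eqP => [x0|-> i _]; last by rewrite mxE expr0n eqxx.
apply/rowP => i; have := x0 i (mem_index_enum _).
by rewrite sqrf_eq0 mxE => /eqP.
Qed.

Lemma sqnormZ m c (x : 'rV[R]_m) : sqnorm (c *: x) = c ^+ 2 * sqnorm x.
Proof. by rewrite mulr_sumr; apply: eq_bigr => i _; rewrite mxE exprMn. Qed.

Lemma sqnorm_continuous m : continuous (@sqnorm m).
Proof.
apply: continuous_big => [|i _ x]; first exact: add_continuous.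
have cxi := @coord_continuous R 1 m 0 i x.
exact: (cvgM cxi cxi).
Qed.

Lemma gauge_sqrt (W : normedModType R) (A : set W) (N : W -> R) :
  continuous N -> (forall (c : R) x, N (c *: x) = c ^+ 2 * N x) ->
  (forall x, x != 0 -> 0 < N x) -> gauge A (fun x => Num.sqrt (N x)).
Proof.
move=> cN NZ N0; split.
- apply: continuous_subspaceT => x.
  by apply: continuous_comp; [exact: cN|exact: sqrt_continuous].
- by move=> c x c0; rewrite NZ sqrtrM ?sqr_ge0// sqrtr_sqr gtr0_norm.
- by move=> x _ x0; rewrite sqrtr_gt0 N0.
Qed.

Lemma slice_sqrt (W : normedModType R) (A : set W) (N : W -> R) :
  (forall x, 0 <= N x) ->
  slice A (fun x => Num.sqrt (N x)) = [set x | A x /\ N x = 1].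
Proof.
move=> N0; apply/seteqP; split => x /= [Ax Nx]; split => //.
  by rewrite -(sqr_sqrtr (N0 x)) Nx expr1n.
by rewrite Nx sqrtr1.
Qed.

Lemma conical_sphere_homeomorphic (V : finType) (D : {set {set V}}) :
  conical_sphere R D ->
  exists n, homeomorphic (set_type (realization R D))
                         (set_type (unit_sphere R n)).
Proof.
move=> [m [f [g h]]]; exists m; rewrite realization_slice.
have -> : unit_sphere R m = slice setT (fun x => Num.sqrt (sqnorm x)).
  by rewrite slice_sqrt; [apply/seteqP; split => x // []|exact: sqnorm_ge0].
apply: homeomorphic_slice h (gauge_mass D) (gauge_sqrt _ _ _ _).
- exact: sqnorm_continuous.
- by move=> c x; exact: sqnormZ.
- by move=> x x0; rewrite lt_neqAle eq_sym sqnorm_eq0 x0 sqnorm_ge0.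
Qed.

Definition hemisphere m : set ('rV[R]_m * R) :=
  [set z | halfspace z /\ sqnorm z.1 + z.2 ^+ 2 = 1].

Lemma hemisphere_homeomorphic m :
  homeomorphic (set_type (@hemisphere m)) (set_type (unit_ball R m)).
Proof.
pose lift (x : 'rV[R]_m) := (x, Num.sqrt (1 - sqnorm x)).
apply: (homeomorphic_set_type (f := fst) (g := lift)).
- by apply: continuous_subspaceT => z; exact: cvg_fst.
- apply/continuous_subspaceT/continuous_pair => x; first exact: cvg_id.
  apply: continuous_comp; last exact: sqrt_continuous.
  exact: (cvgB (cvg_cst (1 : R)) (@sqnorm_continuous m x)).
- by move=> z [_ z1]; rewrite /unit_ball /= -z1 lerDl sqr_ge0.
- move=> x x1; split; first exact: sqrtr_ge0.
  by rewrite /= sqr_sqrtr ?subr_ge0// addrC subrK.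
- move=> [x r] [/= r0 xr]; rewrite /lift /= -xr addrAC subrr add0r sqrtr_sqr.
  by rewrite ger0_norm.
- by [].
Qed.

Lemma conical_ball_homeomorphic (V : finType) (D B : {set {set V}}) :
  conical_ball R D B ->
  exists n, homeomorphic (set_type (realization R D))
                         (set_type (unit_ball R n)).
Proof.
move=> [m [f [g [h _]]]]; exists m; rewrite realization_slice.
apply: homeomorphic_trans (hemisphere_homeomorphic m).
pose N (z : 'rV[R]_m * R) := sqnorm z.1 + z.2 ^+ 2.
have N0 z : 0 <= N z by rewrite addr_ge0 ?sqnorm_ge0 ?sqr_ge0.
have -> : @hemisphere m = slice (@halfspace R _) (fun z => Num.sqrt (N z)).
  by rewrite slice_sqrt.
apply: homeomorphic_slice h (gauge_mass D) (gauge_sqrt _ _ _ _).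
- move=> z; apply: cvgD.
    exact: (continuous_comp_fst (@sqnorm_continuous m)).
  exact: (cvgM (@cvg_snd _ _ _ _ _) (@cvg_snd _ _ _ _ _)).
- by move=> c z; rewrite /N sqnormZ mulrDr -exprMn.
- move=> [x r] xr; rewrite lt_neqAle N0 andbT eq_sym; apply: contra xr.
  rewrite paddr_eq0 ?sqnorm_ge0 ?sqr_ge0//= sqnorm_eq0 sqrf_eq0.
  by move=> /andP[/eqP-> /eqP->].
Qed.

End Norms.

(** * Complexes of families of functions *)

Section Families.
Import mathcomp.boot.fintype mathcomp.boot.finset.
Local Open Scope set_scope.
Variables (X Y : finType).
Implicit Types (T : {set {ffun X -> Y}}) (f g : {ffun X -> Y}).
Implicit Types (F : {set X * Y}).

Definition set_value f x y : {ffun X -> Y} :=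
  [ffun z => if z == x then y else f z].

Lemma set_value_eq f x y : set_value f x y x = y.
Proof. by rewrite ffunE eqxx. Qed.

Lemma set_value_id f x y z : f x = y -> set_value (set_value f x z) x y = f.
Proof. by move=> <-; apply/ffunP => t; rewrite !ffunE; case: eqP => [->|]. Qed.

Definition set_value_stable T x y :=
  {in T, forall f, set_value f x y \in T}.

(* The pair [(x, y)] is the shedding vertex: the two subfamilies give its link
   and its deletion. *)
Inductive sheddable : {set {ffun X -> Y}} -> Prop :=
| sheddable1 f : sheddable [set f]
| sheddable_step T x y :
    [set f in T | f x != y] != set0 ->
    set_value_stable T x y ->
    sheddable [set f in T | f x != y] ->
    sheddable [set f in T | f x == y] ->
    sheddable T.

Definition functions_in F : {set {ffun X -> Y}} := [set f | graph f \subset F].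

Lemma functions_inP F f :
  reflect (forall x, (x, f x) \in F) (f \in functions_in F).
Proof.
rewrite inE; apply: (iffP subsetP) => [fF x|fF [x y]].
  by apply: fF; rewrite inE.
by rewrite inE /= => /eqP ->.
Qed.

Lemma functions_in_set_value F f x y :
  f \in functions_in F -> (x, y) \in F -> set_value f x y \in functions_in F.
Proof.
move=> /functions_inP fF xyF; apply/functions_inP => z; rewrite ffunE.
by case: eqP => [->|].
Qed.

Lemma functions_in_setD1 F x y :
  functions_in (F :\ (x, y)) = [set f in functions_in F | f x != y].
Proof.
apply/setP => f; rewrite [RHS]inE.
apply/functions_inP/andP => [fF|[/functions_inP fF fxy] z].
  split; last by apply: contraTneq (fF x) => ->; rewrite !inE eqxx.
  by apply/functions_inP => z; have := fF z; rewrite inE => /andP[].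
by rewrite !inE fF andbT; apply: contra fxy => /eqP[-> ->].
Qed.

Variables (V : finType) (iota : X * Y -> V) (E : {set X * Y}).
Hypothesis iota_inj : {in E &, injective iota}.
Implicit Types (C : {set V}).

Definition avoids C f := [forall x, iota (x, f x) \notin C].

Definition family_complex T F : {set {set V}} :=
  [set C : {set V} | (C \subset iota @: F) && [exists f in T, avoids C f]].

Lemma avoidsP C f : reflect (forall x, iota (x, f x) \notin C) (avoids C f).
Proof. exact: forallP. Qed.

Lemma family_complexP T F C :
  reflect (C \subset iota @: F /\ exists2 f, f \in T & avoids C f)
          (C \in family_complex T F).
Proof.
rewrite inE; apply: (iffP andP) => -[CA].
  by move=> /exists_inP[f fT fC]; split => //; exists f.
by move=> [f fT fC]; split => //; apply/exists_inP; exists f.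
Qed.

Lemma avoidsS C C' f : C \subset C' -> avoids C' f -> avoids C f.
Proof.
move=> /subsetP CC' /avoidsP fC'; apply/avoidsP => x; apply: contra (fC' x).
exact: CC'.
Qed.

Lemma avoids_set_value C f x y :
  avoids C f -> iota (x, y) \notin C -> avoids C (set_value f x y).
Proof.
by move=> /avoidsP fC yC; apply/avoidsP => z; rewrite ffunE; case: eqP => [->|].
Qed.

Lemma down_closed_family_complex T F : down_closed (family_complex T F).
Proof.
move=> C C' /family_complexP[C'F [f fT fC']] CC'; apply/family_complexP.
by split; [exact: subset_trans C'F|exists f => //; exact: avoidsS fC'].
Qed.

Lemma family_complexU T T' F :
  family_complex (T :|: T') F = family_complex T F :|: family_complex T' F.
Proof.
apply/setP => C; rewrite in_setU; apply/family_complexP/orP.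
  move=> [CF [f]]; rewrite inE => /orP[] fT fC; [left|right];
    by apply/family_complexP; split => //; exists f.
by move=> [] /family_complexP[CF [f fT fC]]; split => //; exists f;
  rewrite // inE fT ?orbT.
Qed.

Lemma imset_setD1 F p : F \subset E -> p \in F ->
  iota @: (F :\ p) = iota @: F :\ iota p.
Proof.
move=> /subsetP sF pF; apply/setP => u; rewrite in_setD1.
apply/imsetP/andP => [[q]|[up /imsetP[q qF e]]].
  rewrite in_setD1 => /andP[qp qF] ->; split; last exact: imset_f.
  by apply: contra qp => /eqP/iota_inj ->//; exact: sF.
exists q => //; rewrite in_setD1 qF andbT.
by apply: contra up => /eqP <-; rewrite e.
Qed.

Section InSubset.
Variable F : {set X * Y}.
Hypothesis sF : F \subset E.

Lemma avoids_setU1 C f x y : f \in functions_in F -> (x, y) \in F ->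
  avoids (iota (x, y) |: C) f = (f x != y) && avoids C f.
Proof.
move=> /functions_inP fF xyF; apply/avoidsP/andP => [fC|[fxy /avoidsP fC] z].
  split; first by apply: contraTneq (fC x) => ->; rewrite !inE eqxx.
  by apply/avoidsP => z; have := fC z; rewrite !inE negb_or => /andP[].
rewrite !inE negb_or fC andbT; apply: contra fxy => /eqP/iota_inj e.
by have [] := e (subsetP sF _ (fF z)) (subsetP sF _ xyF) => <- <-.
Qed.

Lemma link_family_complex T x y :
  T \subset functions_in F -> (x, y) \in F ->
  link (iota (x, y)) (family_complex T F) =
  family_complex [set f in T | f x != y] (F :\ (x, y)).
Proof.
move=> /subsetP TF xyF; apply/setP => C; rewrite inE.
apply/andP/family_complexP; rewrite imset_setD1// subsetD1.
  move=> [vC /family_complexP[vCF [f fT]]]; rewrite vC andbT.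
  rewrite avoids_setU1 ?TF// => /andP[fxy fC]; split.
    by apply: subset_trans vCF; exact: subsetU1.
  by exists f; rewrite // inE fT.
move=> [/andP[CF vC] [f]]; rewrite inE => /andP[fT fxy] fC.
split => //; apply/family_complexP; split.
  by rewrite subUset sub1set imset_f.
by exists f => //; rewrite avoids_setU1 ?TF// fxy.
Qed.

Lemma deletion_family_complex T x y :
  set_value_stable T x y ->
  deletion (iota (x, y)) (family_complex T F) =
  family_complex [set f in T | f x == y] F.
Proof.
move=> Txy; apply/setP => C; rewrite inE; apply/andP/family_complexP.
  move=> [/family_complexP[CF [f fT fC]] vC]; split => //.
  exists (set_value f x y); first by rewrite inE Txy// set_value_eq eqxx.
  exact: avoids_set_value.
move=> [CF [f]]; rewrite inE => /andP[fT /eqP fxy] fC; split.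
  by apply/family_complexP; split => //; exists f.
by move/avoidsP: fC => /(_ x); rewrite fxy.
Qed.

Lemma family_complex1 f :
  family_complex [set f] F = powerset (iota @: F :\: iota @: graph f).
Proof.
apply/setP => C; rewrite [RHS]inE subsetD; apply/family_complexP/andP.
  move=> [CF [_ /set1P -> /avoidsP fC]]; split => //.
  rewrite disjoints_subset; apply/subsetP => u uC; rewrite inE.
  by apply: contraL uC => /imsetP[[x y]]; rewrite inE /= => /eqP -> ->.
move=> [CF dC]; split => //; exists f; first exact: set11.
apply/avoidsP => x; move: dC; rewrite disjoint_sym disjoints_subset.
by move=> /subsetP/(_ (iota (x, f x))); rewrite inE; apply;
  rewrite imset_f ?inE.
Qed.

Lemma pure_family_complex T :
  T \subset functions_in F -> pure (family_complex T F).
Proof.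
move=> /subsetP TF.
suff cardC C :
    is_facet (family_complex T F) C -> #|C| = (#|iota @: F| - #|X|)%N.
  by move=> C C' /cardC-> /cardC->.
move=> [/family_complexP[CF [f fT fC]] Cmax].
have fF : graph f \subset F by have := TF _ fT; rewrite inE.
have <- : iota @: F :\: iota @: graph f = C.
  apply: Cmax.
    apply/family_complexP; split; first exact: subsetDl.
    by exists f => //; apply/avoidsP => x; rewrite inE imset_f ?inE.
  apply/subsetP => u uC; rewrite inE (subsetP CF)// andbT; apply: contraL uC.
  by move=> /imsetP[[x y]]; rewrite inE /= => /eqP -> ->; move/avoidsP: fC.
rewrite cardsD (setIidPr _) ?imsetS//; congr (_ - _)%N.
rewrite card_in_imset; last first.
  by apply: sub_in2 iota_inj => p /(subsetP fF)/(subsetP sF).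
have -> : graph f = [set (x, f x) | x : X].
  apply/setP => -[x y]; rewrite inE /=.
  by apply/eqP/imsetP => [->|[z _ [-> ->]]//]; exists x.
by rewrite card_imset// => x z [].
Qed.

End InSubset.

Lemma sub_functions_in_setD1 T F x y : T \subset functions_in F ->
  [set f in T | f x != y] \subset functions_in (F :\ (x, y)).
Proof.
move=> /subsetP TF; rewrite functions_in_setD1; apply/subsetP => f.
by rewrite 2![_ \in [set _ in _ | _]]inE => /andP[/TF-> ->].
Qed.

Lemma shed_vertex T F x y : T \subset functions_in F ->
  set_value_stable T x y -> T != set0 -> (x, y) \in F.
Proof.
move=> /subsetP TF Txy /set0Pn[f /Txy/TF/functions_inP/(_ x)].
by rewrite set_value_eq.
Qed.

Lemma sheddable_vertex_decomposable T : sheddable T -> forall F,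
  F \subset E -> T \subset functions_in F ->
  vertex_decomposable (family_complex T F).
Proof.
elim=> {T} [f|T x y T1n0 Txy _ IHlink _ IHdel] F sF TF.
  by rewrite family_complex1; apply: vd_simplex; eexists.
have [f] := set0Pn _ T1n0; rewrite inE => /andP[fT fxy].
have xyF : (x, y) \in F by apply: shed_vertex TF Txy _; apply/set0Pn; exists f.
apply: (@vd_shed _ _ (iota (x, y))); first exact: pure_family_complex.
- apply/family_complexP; split; first by rewrite sub1set imset_f.
  exists f => //; rewrite -[[set _]]setU0 (avoids_setU1 sF)// ?(subsetP TF)//.
  by rewrite fxy; apply/avoidsP => z; rewrite inE.
- rewrite deletion_family_complex//; apply: IHdel => //.
  by rewrite setIdE; exact: subset_trans (subsetIl _ _) TF.
- rewrite link_family_complex//; apply: IHlink.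
    by apply: subset_trans sF; exact: subD1set.
  exact: sub_functions_in_setD1.
Qed.

Lemma set0_family_complex T F : (set0 \in family_complex T F) = (T != set0).
Proof.
apply/family_complexP/set0Pn => [[_ [f fT _]]|[f fT]]; first by exists f.
by split; [exact: sub0set|exists f => //; apply/avoidsP => x; rewrite inE].
Qed.

Lemma family_complex_set0 F : family_complex set0 F = set0.
Proof.
apply/setP => C; rewrite [RHS]inE.
by apply/family_complexP => -[_ [f]]; rewrite inE.
Qed.

Lemma family_complex_setD1 T F p C :
  F \subset E -> p \in F -> iota p \notin C ->
  (C \in family_complex T (F :\ p)) = (C \in family_complex T F).
Proof.
move=> sF pF pC; rewrite ![_ \in family_complex _ _]inE.
by rewrite imset_setD1// subsetD1 pC andbT.
Qed.

Lemma boundary_family_complex1 f F : F \subset E -> f \in functions_in F ->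
  {in family_complex [set f] F, family_complex (functions_in F :\ f) F =i
    [set C : {set V} | C \proper iota @: F :\: iota @: graph f]}.
Proof.
move=> sF fF C; set S := iota @: F :\: iota @: graph f.
have memS p : p \in F -> (iota p \in S) = (p.2 != f p.1).
  move=> pF; rewrite in_setD (imset_f _ pF) andbT; congr (~~ _).
  apply/imsetP/eqP => [[q qf /iota_inj]|pf].
    rewrite !(subsetP sF)// => [-> //|].
      by move: qf; rewrite inE => /eqP.
    by move: fF; rewrite inE => /subsetP; apply.
  by exists p; rewrite // inE pf.
rewrite family_complex1 inE [RHS]inE properE => CS; rewrite CS /=.
apply/family_complexP/subsetPn => [[_ [g]]|[u uS uC]].
  rewrite in_setD1 => /andP[gf /functions_inP gF] /avoidsP gC.
  have [x gfx] : exists x, g x != f x.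
    apply/existsP; apply: contraNT gf; rewrite negb_exists => /forallP gf.
    by apply/eqP/ffunP => x; apply/eqP; have := gf x; rewrite negbK.
  by exists (iota (x, g x)); rewrite ?memS.
have /imsetP[[x y] xyF uE] : u \in iota @: F.
  by move: uS; rewrite inE => /andP[].
move: uS; rewrite uE memS//= => yfx; split.
  by apply: subset_trans CS _; exact: subsetDl.
exists (set_value f x y).
  rewrite in_setD1 functions_in_set_value// andbT; apply: contra yfx => /eqP <-.
  by rewrite set_value_eq.
apply: avoids_set_value; last by rewrite -uE.
have : C \in family_complex [set f] F by rewrite family_complex1 inE.
by move=> /family_complexP[_ [_ /set1P ->]].
Qed.

Lemma conical_family1 (R : realType) f F :
  F \subset E -> f \in functions_in F ->
  if functions_in F \subset [set f]
  then conical_sphere R (family_complex [set f] F)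
  else conical_ball R (family_complex [set f] F)
         (family_complex (functions_in F :\ f) F).
Proof.
move=> sF fF; set S := iota @: F :\: iota @: graph f.
have bd := boundary_family_complex1 sF fF; rewrite -/S in bd.
have S0 : (functions_in F \subset [set f]) = (S == set0).
  apply/negb_inj; rewrite -proper0 -setD_eq0 -(set0_family_complex _ F).
  rewrite bd; first by rewrite inE.
  by rewrite set0_family_complex; apply/set0Pn; exists f; exact: set11.
rewrite S0 family_complex1 -/S; case: eqVneq => [->|Sn0].
  by rewrite powerset0; exact: conical_sphere_empty_face.
apply: eq_conical_ball (conical_ball_simplex R Sn0) => C.
by rewrite -family_complex1 => /bd.
Qed.

Section Shedding.
Variables (F : {set X * Y}) (T : {set {ffun X -> Y}}) (x : X) (y : Y).
Hypotheses (sF : F \subset E) (TF : T \subset functions_in F).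
Hypothesis Txy : set_value_stable T x y.
Hypothesis T1n0 : [set f in T | f x != y] != set0.
Let v := iota (x, y).
Let T' := functions_in F :\: T.

Let xyF : (x, y) \in F.
Proof.
apply: shed_vertex TF Txy _; have [f] := set0Pn _ T1n0.
by rewrite inE => /andP[fT _]; apply/set0Pn; exists f.
Qed.

Lemma functions_in_setD_slice :
  functions_in F :\: [set f in T | f x == y] = [set f in T | f x != y] :|: T'.
Proof.
apply/setP => f; rewrite !inE; have := subsetP TF f; rewrite inE.
by case: (f \in T) => [->|_] //=; rewrite ?andbT ?orbF ?orbT.
Qed.

Lemma functions_in_setD1_setD :
  functions_in (F :\ (x, y)) :\: [set f in T | f x != y] =
  [set f in T' | f x != y].
Proof.
rewrite functions_in_setD1; apply/setP => f; rewrite !inE.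
by case: (f x != y); rewrite ?andbT ?andbF.
Qed.

Lemma link_complement_sub :
  link v (family_complex T F) :&: family_complex T' F
    \subset link v (family_complex T' F).
Proof.
rewrite !link_family_complex// ?subsetDl//; apply/subsetP => C; rewrite inE.
move=> /andP[/family_complexP[CF [f]]]; rewrite inE => /andP[fT fxy] fC.
move=> /family_complexP[_ [g]]; rewrite inE => /andP[gT gF] gC.
apply/family_complexP; split => //.
have [gxy|gxy] := eqVneq (g x) y; last first.
  by exists g; rewrite // inE gxy inE gT gF.
exists (set_value g x (f x)).
  rewrite inE set_value_eq fxy andbT inE functions_in_set_value//; last first.
    exact/functions_inP/(subsetP TF).
  by rewrite andbT; apply: contra gT => /Txy; rewrite set_value_id.
by apply: avoids_set_value => //; exact/avoidsP.
Qed.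

Lemma deletion_boundary_family :
  {in family_complex [set f in T | f x == y] F,
    family_complex (functions_in F :\: [set f in T | f x == y]) F =i
    link v (family_complex T F) :|: family_complex T' F}.
Proof.
move=> C; rewrite -deletion_family_complex// inE => /andP[_ vC].
rewrite functions_in_setD_slice family_complexU !in_setU link_family_complex//.
by rewrite family_complex_setD1.
Qed.

End Shedding.

Lemma sheddable_conical (R : realType) T : sheddable T -> forall F,
  F \subset E -> T \subset functions_in F ->
  if functions_in F \subset T then conical_sphere R (family_complex T F)
  else conical_ball R (family_complex T F)
         (family_complex (functions_in F :\: T) F).
Proof.
elim=> {T} [f|T x y T1n0 Txy _ IHlink _ IHdel] F sF TF.
  by apply: conical_family1 => //; rewrite -sub1set.
set T' := functions_in F :\: T.
have xyF : (x, y) \in F.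
  apply: shed_vertex TF Txy _; apply: contra T1n0 => /eqP ->.
  by rewrite -subset0; apply/subsetP => f; rewrite inE => /andP[].
have del_ball : conical_ball R (deletion (iota (x, y)) (family_complex T F))
    (link (iota (x, y)) (family_complex T F) :|: family_complex T' F).
  rewrite deletion_family_complex//.
  apply: eq_conical_ball (deletion_boundary_family sF TF Txy T1n0) _.
  have TF2 : [set f in T | f x == y] \subset functions_in F.
    by rewrite setIdE; exact: subset_trans (subsetIl _ _) TF.
  have := IHdel F sF TF2; rewrite ifN//.
  have [f] := set0Pn _ T1n0; rewrite inE => /andP[fT fxy].
  by apply/subsetPn; exists f; rewrite ?(subsetP TF)// inE (negbTE fxy) andbF.
case: ifPn => [full|nfull].
  apply: (@conical_sphere_glue _ _ (iota (x, y))).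
    exact: down_closed_family_complex.
  move: del_ball; rewrite (_ : T' = set0) ?family_complex_set0 ?setU0//.
  by apply/eqP; rewrite setD_eq0.
apply: (@conical_ball_glue _ _ (iota (x, y))) => //.
- exact: down_closed_family_complex.
- exact: down_closed_family_complex.
- exact: link_complement_sub.
have link_sub := link_complement_sub sF TF Txy T1n0.
rewrite !link_family_complex ?subsetDl// in link_sub *.
have sF' : F :\ (x, y) \subset E by apply: subset_trans sF; exact: subD1set.
have := IHlink _ sF' (sub_functions_in_setD1 _ _ TF).
rewrite -setD_eq0 functions_in_setD1_setD// ifN//.
rewrite -(set0_family_complex _ (F :\ (x, y))); apply: (subsetP link_sub).
by rewrite inE !set0_family_complex T1n0 setD_eq0.
Qed.

End Families.

(** * Poset tableaux *)

Section PosetTableaux.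
Import mathcomp.boot.fintype mathcomp.boot.finset.
Local Open Scope set_scope.

Lemma ex_minimal d (T : finPOrderType d) (P : pred T) x0 : P x0 ->
  exists2 x, P x & forall z, P z -> ~~ (z < x)%O.
Proof.
move=> Px0; pose below (x : T) := #|[set z : T | (z < x)%O]|.
have [x Px xmin] := arg_minnP below Px0; exists x => // z /xmin.
apply: contraL => zx; rewrite -ltnNge; apply: proper_card; apply/properP; split.
  by apply/subsetP => t; rewrite !inE => /lt_trans; apply.
by exists z; rewrite !inE ?ltxx.
Qed.

Variables (dX dY : Order.disp_t) (X : finPOrderType dX) (Y : finPOrderType dY).
Variable Psi : {set X * X}.
Hypothesis Psi_lt : forall x1 x2 : X, (x1, x2) \in Psi -> (x1 < x2)%O.
Implicit Types (Yx : X -> {set Y}) (f g : {ffun X -> Y}).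
Implicit Types (T : {set {ffun X -> Y}}) (x : X).

Lemma poset_tableauxP Yx f :
  reflect [/\ forall x, f x \in Yx x,
              forall x1 x2, (x1 <= x2)%O -> (f x1 <= f x2)%O &
              forall x1 x2, (x1, x2) \in Psi -> (f x1 < f x2)%O]
          (f \in poset_tableaux Yx Psi).
Proof.
rewrite [X in reflect _ X]inE.
apply: (iffP and3P) => [[/forallP fY fle flt]|[fY fle flt]]; split.
- exact: fY.
- by move=> x1 x2; move/forallP: fle => /(_ x1)/forallP/(_ x2)/implyP.
- by move=> x1 x2; move/forallP: flt => /(_ x1)/forallP/(_ x2)/implyP.
- exact/forallP.
- by apply/forallP => x1; apply/forallP => x2; apply/implyP; exact: fle.
- by apply/forallP => x1; apply/forallP => x2; apply/implyP; exact: flt.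
Qed.

Definition restrict_values Yx x (Z : {set Y}) : X -> {set Y} :=
  fun z => if z == x then Yx z :&: Z else Yx z.

Lemma restrict_values_sub Yx x Z z : restrict_values Yx x Z z \subset Yx z.
Proof. by rewrite /restrict_values; case: eqP => // _; exact: subsetIl. Qed.

Lemma poset_tableaux_restrict Yx x (Z : {set Y}) :
  poset_tableaux (restrict_values Yx x Z) Psi =
  [set f in poset_tableaux Yx Psi | f x \in Z].
Proof.
apply/setP => f; rewrite [RHS]inE.
apply/poset_tableauxP/andP => [[fY fle flt]|[/poset_tableauxP[fY fle flt] fZ]].
  split; last by have := fY x; rewrite /restrict_values eqxx inE => /andP[].
  apply/poset_tableauxP; split => // z.
  exact: (subsetP (restrict_values_sub Yx x Z z)).
split => // z; rewrite /restrict_values.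
by case: eqP => [->|]; rewrite ?inE ?fY.
Qed.

Lemma poset_tableaux_stable Yx x y :
  {in poset_tableaux Yx Psi &, forall f g z, (z < x)%O -> f z = g z} ->
  {in poset_tableaux Yx Psi, forall f, (y <= f x)%O} ->
  (exists2 g, g \in poset_tableaux Yx Psi & g x = y) ->
  set_value_stable (poset_tableaux Yx Psi) x y.
Proof.
move=> eq_below y_min [g gT gx] f fT.
have fg z : (z < x)%O -> f z = g z by exact: eq_below.
have yf := y_min f fT.
have /poset_tableauxP[fY fle flt] := fT.
have /poset_tableauxP[gY gle glt] := gT.
apply/poset_tableauxP; split=> [z|x1 x2 x12|x1 x2 x12]; rewrite !ffunE.
- by case: eqP => [->|//]; rewrite -gx.
- case: (eqVneq x1 x) x12 => [-> x2x|x1x x12];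
    case: (eqVneq x2 x) => [x2E|_].
  + by [].
  + exact: le_trans yf (fle _ _ x2x).
  + by rewrite fg -?gx; [apply: gle; rewrite -x2E|rewrite lt_neqAle x1x -x2E].
  + exact: fle.
- case: (eqVneq x1 x) (Psi_lt x12) => [x1E x1x2|_ x1x2];
    case: (eqVneq x2 x) => [x2E|_].
  + by move: x1x2; rewrite x1E x2E ltxx.
  + by apply: le_lt_trans yf _; apply: flt; rewrite -x1E.
  + by rewrite fg -?gx; [apply: glt; rewrite -x2E|rewrite -x2E].
  + exact: flt.
Qed.

Definition varies T x :=
  [exists f in T, exists g in T, f x != g x].

Lemma variesPn T x :
  reflect {in T &, forall f g, f x = g x} (~~ varies T x).
Proof.
rewrite negb_exists_in; apply: (iffP forall_inP) => eqT f.
  move=> g fT gT; have := eqT f fT; rewrite negb_exists_in.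
  by move=> /forall_inP/(_ g gT); rewrite negbK => /eqP.
move=> fT; rewrite negb_exists_in; apply/forall_inP => g gT.
by rewrite negbK (eqT f g fT gT).
Qed.

Lemma ex_least_value T x f0 : f0 \in T ->
  {in T &, forall f g, (f x <= g x)%O \/ (g x <= f x)%O} ->
  exists2 g, g \in T & {in T, forall f, (g x <= f x)%O}.
Proof.
move=> f0T total_x; pose attained y := [exists f in T, f x == y].
have [|y /exists_inP[g gT /eqP gxy] ymin] := @ex_minimal _ _ attained (f0 x).
  by apply/exists_inP; exists f0.
exists g => // f fT; have [//|fg] := total_x g f gT fT.
have := ymin (f x); rewrite lt_neqAle -gxy fg andbT negbK => /(_ _)/eqP -> //.
by apply/exists_inP; exists f.
Qed.

Lemma poset_tableaux_shedding Yx :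
  {in poset_tableaux Yx Psi &,
    forall f g x, (f x <= g x)%O \/ (g x <= f x)%O} ->
  (exists x, varies (poset_tableaux Yx Psi) x) ->
  exists x y,
    [/\ exists2 f, f \in poset_tableaux Yx Psi & f x != y,
        exists2 f, f \in poset_tableaux Yx Psi & f x == y &
        set_value_stable (poset_tableaux Yx Psi) x y].
Proof.
set T := poset_tableaux Yx Psi => total_T [x0 /ex_minimal[x varies_x xmin]].
have /exists_inP[f1 f1T /exists_inP[f2 f2T f12]] := varies_x.
have [|g gT g_least] := ex_least_value (x := x) f1T.
  by move=> f f' fT f'T; exact: total_T.
exists x, (g x); split; [|by exists g|].
  have [e|] := eqVneq (f1 x) (g x); last by exists f1.
  by exists f2; rewrite // -e eq_sym.
apply: poset_tableaux_stable => //; last by exists g.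
move=> f f' fT f'T z zx; apply: (variesPn T z) => //.
by apply: contraL zx; exact: xmin.
Qed.

Lemma sheddable_poset_tableaux Yx :
  (forall x y1 y2, y1 \in Yx x -> y2 \in Yx x ->
    (y1 <= y2)%O \/ (y2 <= y1)%O) ->
  poset_tableaux Yx Psi != set0 -> sheddable (poset_tableaux Yx Psi).
Proof.
have [n] := ubnP #|poset_tableaux Yx Psi|; elim: n Yx => // n IHn Yx.
set T := poset_tableaux Yx Psi; rewrite ltnS => Tn total_Yx Tn0.
have IH x (Z : {set Y}) f : f \in T -> f x \notin Z ->
    [set f in T | f x \in Z] != set0 -> sheddable [set f in T | f x \in Z].
  move=> fT fZ; rewrite -poset_tableaux_restrict; apply: IHn.
    rewrite poset_tableaux_restrict; apply: leq_trans Tn; apply: proper_card.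
    apply/properP; split; first by rewrite setIdE subsetIl.
    by exists f; rewrite // inE negb_and fZ orbT.
  move=> z y1 y2 /(subsetP (restrict_values_sub _ _ _ _)) y1Y.
  by move=> /(subsetP (restrict_values_sub _ _ _ _)); exact: total_Yx.
have [/existsP varies_T|none] := boolP [exists x, varies T x]; last first.
  have [f fT] := set0Pn _ Tn0.
  rewrite (_ : T = [set f]); first exact: sheddable1.
  apply/setP => g; rewrite [RHS]inE; apply/idP/eqP => [gT|->//].
  apply/ffunP => x; apply: (variesPn T x) => //.
  by move: none; rewrite negb_exists => /forallP.
have [|x [y [[f fT fxy] [g gT gxy] Txy]]] := poset_tableaux_shedding _ varies_T.
  move=> f g /poset_tableauxP[fY _ _] /poset_tableauxP[gY _ _] x.
  exact: total_Yx.
have neqE : [set f in T | f x != y] = [set f in T | f x \in ~: [set y]].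
  by apply/setP => h; rewrite !inE.
have eqE : [set f in T | f x == y] = [set f in T | f x \in [set y]].
  by apply/setP => h; rewrite !inE.
have neq_n0 : [set f in T | f x != y] != set0.
  by apply/set0Pn; exists f; rewrite inE fT.
have eq_n0 : [set f in T | f x == y] != set0.
  by apply/set0Pn; exists g; rewrite inE gT.
apply: (sheddable_step (x := x) (y := y)) => //.
  by rewrite neqE; apply: (IH x _ g); rewrite -?neqE// !inE gxy.
by rewrite eqE; apply: (IH x _ f); rewrite -?eqE// inE.
Qed.

End PosetTableaux.

Section TableauComplexes.
Import mathcomp.boot.fintype mathcomp.boot.finset.
Local Open Scope set_scope.
Variables (X Y : finType) (E : {set X * Y}).

Lemma tableau_vertex_inj : {in E &, injective (tableau_vertex E)}.
Proof.
by move=> p q pE _ /setP/(_ p); rewrite !inE eqxx pE !andbT => /esym/negbFE/eqP.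
Qed.

Lemma tableau_complexE (T : {set {ffun X -> Y}}) : T \subset functions_in E ->
  tableau_complex T E = family_complex (tableau_vertex E) T E.
Proof.
move=> /subsetP TE; apply/setP => C; apply/imsetP/family_complexP.
  move=> [F]; rewrite inE => /andP[FE /exists_inP[f fT /subsetP fF]] ->.
  split; first by apply: imsetS; exact: subsetDl.
  exists f => //; apply/avoidsP => x; apply/imsetP => -[q].
  rewrite inE => /andP[qF qE] /tableau_vertex_inj e; move: qF.
  by rewrite -e ?fF ?inE//; have /functions_inP := TE f fT.
move=> [CE [f fT /avoidsP fC]].
exists [set p in E | tableau_vertex E p \notin C].
  rewrite inE powersetE; apply/andP; split; first by rewrite setIdE subsetIl.
  apply/exists_inP; exists f => //.
  apply/subsetP => -[x y]; rewrite !inE /= => /eqP ->; rewrite fC andbT.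
  by have /functions_inP := TE f fT.
apply/setP => u; apply/idP/imsetP => [uC|[p]].
  have /imsetP[p pE e] := subsetP CE _ uC; exists p => //.
  by rewrite !inE pE /= andbT negbK -e.
by rewrite !inE => /andP[+ pE] ->; rewrite pE /= negbK.
Qed.

End TableauComplexes.

Lemma ball_or_sphere_void (R : realType) (V : finType) :
  ball_or_sphere R (finset.set0 : {set {set V}}).
Proof.
exists 0%N; right.
rewrite (_ : realization R _ = set0); last first.
  by apply/seteqP; split => // p [_ _]; rewrite inE.
rewrite (_ : unit_sphere R 0 = set0); last first.
  apply/seteqP; split => // x; rewrite /unit_sphere /= big_ord0.
  by move=> /esym/eqP; rewrite oner_eq0.
apply: (homeomorphic_set_type (f := fun=> 0 : 'rV[R]_0)
  (g := fun=> 0 : 'rV[R]_#|V|)); by [exact: continuous_subspace0|].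
Qed.

Theorem theorem2p8 (R : realType) (dX dY : Order.disp_t)
    (X : finPOrderType dX) (Y : finPOrderType dY)
    (Yx : X -> {set Y})
    (Yx_total : forall (x : X) (y1 y2 : Y),
        y1 \in Yx x -> y2 \in Yx x -> (y1 <= y2)%O \/ (y2 <= y1)%O)
    (Psi : {set X * X})
    (Psi_lt : forall x1 x2 : X, (x1, x2) \in Psi -> (x1 < x2)%O)
    (E : {set X * Y})
    (E_sup : (\bigcup_(f in poset_tableaux Yx Psi) graph f)%SET \subset E) :
  ball_or_sphere R (tableau_complex (poset_tableaux Yx Psi) E) /\
  vertex_decomposable (tableau_complex (poset_tableaux Yx Psi) E).
Proof.
set T := poset_tableaux Yx Psi.
have TE : T \subset functions_in E.
  apply/fintype.subsetP => f fT; rewrite inE.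
  by move/finset.bigcupsP: E_sup; exact.
rewrite tableau_complexE//.
have [->|Tn0] := eqVneq T finset.set0.
  rewrite family_complex_set0.
  by split; [exact: ball_or_sphere_void|exact: vd_void].
have inj := @tableau_vertex_inj _ _ E; have EE := fintype.subxx (mem E).
have shed : sheddable T by exact: sheddable_poset_tableaux.
split; last exact: sheddable_vertex_decomposable inj _ shed _ EE TE.
have := sheddable_conical inj R shed EE TE; case: ifP => _.
  by move=> /conical_sphere_homeomorphic[n homeo]; exists n; right.
by move=> /conical_ball_homeomorphic[n homeo]; exists n; left.
Qed.
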